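(* $\displaystyle\lim_{n\to\infty}\frac{t(4,n)}{r(4,n)}=0.$
   Context: Let $G=(V,E)$ be a finite simple graph. A set $X\subseteq V$ is irredundant if each vertex $x\in X$ is either isolated in the induced subgraph $\langle X\rangle$ or has a private neighbor, i.e. a vertex $y\in V\setminus X$ adjacent to $x$ and to no other vertex of $X$. For positive integers $m,n$: the mixed Ramsey number $t(m,n)$ is the smallest integer $N$ such that for every red-blue coloring of the edges of $K_N$, either the blue spanning subgraph contains an $m$-element irredundant set or the red spanning subgraph contains an $n$-element independent set; the Ramsey number $r(m,n)$ is the smallest integer $N$ such that for every red-blue coloring of the edges of $K_N$, either the blue spanning subgraph contains an $m$-element independent set or the red spanning subgraph contains an $n$-element independent set. *)

(* Defs.v *)
From mathcomp Require Import all_boot.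

Set Implicit Arguments.
Unset Strict Implicit.
Unset Printing Implicit Defensive.

(* A finite simple graph is a finType with a symmetric irreflexive relation. *)
Section Graph.
Variables (T : finType) (e : rel T).

Definition independent (X : {set T}) : bool :=
  [forall x in X, forall y in X, ~~ e x y].

Definition isolated_in (X : {set T}) (x : T) : bool :=
  [forall y in X, ~~ e x y].

Definition private_neighbor (X : {set T}) (x y : T) : bool :=
  [&& y \notin X, e x y & [forall z in X, (z != x) ==> ~~ e z y]].

Definition irredundant (X : {set T}) : bool :=
  [forall x in X, isolated_in X x || [exists y, private_neighbor X x y]].

Definition has_independent (m : nat) : bool :=
  [exists X : {set T}, (#|X| == m) && independent X].

Definition has_irredundant (m : nat) : bool :=
  [exists X : {set T}, (#|X| == m) && irredundant X].

Lemma independent_irredundant X : independent X -> irredundant X.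
Proof.
move=> /forall_inP iX; apply/forall_inP => x xX; apply/orP; left.
exact: iX x xX.
Qed.

Lemma has_independent_irredundant m : has_independent m -> has_irredundant m.
Proof.
case/existsP=> X /andP[cX iX]; apply/existsP; exists X.
by rewrite cX independent_irredundant.
Qed.

End Graph.

(* A red-blue coloring of the edges of K_N; only the values on two-element
   sets of vertices matter. *)
Definition coloring (N : nat) := {ffun {set 'I_N} -> bool}.
Definition blue : bool := true.
Definition red : bool := false.

Definition color_graph (N : nat) (c : coloring N) (b : bool) : rel 'I_N :=
  [rel x y | (x != y) && (c [set x; y] == b)].

Lemma color_graph_sym N (c : coloring N) b : symmetric (color_graph c b).
Proof. by move=> x y; rewrite /color_graph /= eq_sym setUC. Qed.

Lemma color_graph_irr N (c : coloring N) b : irreflexive (color_graph c b).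
Proof. by move=> x; rewrite /color_graph /= eqxx. Qed.

Definition ramsey_prop (m n N : nat) : bool :=
  [forall c : coloring N, has_independent (color_graph c blue) m
                       || has_independent (color_graph c red) n].

Definition mixed_ramsey_prop (m n N : nat) : bool :=
  [forall c : coloring N, has_irredundant (color_graph c blue) m
                       || has_independent (color_graph c red) n].

Lemma independentU1 (T : finType) (e : rel T) (x : T) (X : {set T}) :
  symmetric e -> irreflexive e -> independent e X ->
  (forall y, y \in X -> ~~ e x y) -> independent e (x |: X).
Proof.
move=> se ie /forall_inP iX hx.
apply/forall_inP => y; rewrite !inE => /orP[/eqP->|yX];
  apply/forall_inP => z; rewrite !inE => /orP[/eqP->|zX].
- by rewrite ie.
- exact: hx.
- by rewrite se; exact: hx.
- by have /forall_inP := iX _ yX; apply.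
Qed.

Lemma ramsey_finite (T : finType) (e f : rel T) m n (A : {set T}) :
  symmetric e -> irreflexive e -> symmetric f -> irreflexive f ->
  (forall x y, ~~ (e x y && f x y)) -> 2 ^ (m + n) <= #|A| ->
  (exists X : {set T}, [/\ X \subset A, #|X| = m & independent e X]) \/
  (exists X : {set T}, [/\ X \subset A, #|X| = n & independent f X]).
Proof.
move=> se ie sf iff ef; have [k] := ubnP (m + n).
elim: k m n A => // k IH [|m] [|n] A /=.
- by left; exists set0; rewrite sub0set cards0; split=> //;
  apply/forall_inP=> x; rewrite inE.
- by left; exists set0; rewrite sub0set cards0; split=> //;
  apply/forall_inP=> x; rewrite inE.
- by right; exists set0; rewrite sub0set cards0; split=> //;
  apply/forall_inP=> x; rewrite inE.
move=> lk cA.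
have /card_gt0P[x xA] : 0 < #|A| by apply: leq_trans cA; rewrite expn_gt0.
pose B := [set y in A :\ x | ~~ e x y]; pose C := [set y in A :\ x | e x y].
have cBC : #|A| = (#|B| + #|C|).+1.
  rewrite (cardsD1 x A) xA add1n -(cardsID [set y | ~~ e x y] (A :\ x)).
  congr (_ + _).+1; apply: eq_card => y; rewrite !inE //.
  by rewrite negbK andbC.
have xB (D : {set T}) : D \subset A :\ x -> x \notin D.
  by move=> sD; apply/negP => /(subsetP sD); rewrite !inE eqxx.
have sBA : B \subset A :\ x by apply/subsetP=> y; rewrite inE => /andP[].
have sCA : C \subset A :\ x by apply/subsetP=> y; rewrite inE => /andP[].
have [hB|hB] := leqP (2 ^ (m + n.+1)) #|B|.
- have [] := IH m n.+1 B _ hB; first by rewrite addSn ltnS in lk.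
  + move=> [X [sX cX iX]]; left; exists (x |: X); split.
    * by rewrite subUset sub1set xA (subset_trans sX (subset_trans sBA (subD1set _ _))).
    * by rewrite cardsU1 (xB _ (subset_trans sX sBA)) cX.
    * apply: independentU1 => // y /(subsetP sX).
      by rewrite inE => /andP[].
  + move=> [X [sX cX iX]]; right; exists X; split=> //.
    exact: subset_trans sX (subset_trans sBA (subD1set _ _)).
have hC : 2 ^ (m.+1 + n) <= #|C|.
  move: cA hB; rewrite cBC addSn expnS mul2n -addnn -addSnnS => cA hB.
  have: 2 ^ (m.+1 + n) + 2 ^ (m.+1 + n) <= 2 ^ (m.+1 + n) + #|C|.
    by apply: leq_trans cA _; rewrite -addSn leq_add2r.
  by rewrite leq_add2l.
have [] := IH m.+1 n C _ hC; first by rewrite addnS ltnS in lk.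
- move=> [X [sX cX iX]]; left; exists X; split=> //.
  exact: subset_trans sX (subset_trans sCA (subD1set _ _)).
- move=> [X [sX cX iX]]; right; exists (x |: X); split.
  + by rewrite subUset sub1set xA (subset_trans sX (subset_trans sCA (subD1set _ _))).
  + by rewrite cardsU1 (xB _ (subset_trans sX sCA)) cX.
  + apply: independentU1 => // y /(subsetP sX).
    rewrite inE => /andP[_ exy].
    by have := ef x y; rewrite exy.
Qed.

Lemma ramsey_ex (m n : nat) : exists N, ramsey_prop m n N.
Proof.
exists (2 ^ (m + n)); apply/forallP => c.
have [|||||||] := @ramsey_finite _ (color_graph c blue) (color_graph c red) m n
  [set: 'I_(2 ^ (m + n))].
- exact: color_graph_sym.
- exact: color_graph_irr.
- exact: color_graph_sym.
- exact: color_graph_irr.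
- by move=> x y; rewrite /color_graph /=; case: (c _); rewrite ?andbF.
- by rewrite cardsT card_ord.
- move=> [X [_ cX iX]]; apply/orP; left; apply/existsP; exists X.
  by rewrite cX eqxx.
- move=> [X [_ cX iX]]; apply/orP; right; apply/existsP; exists X.
  by rewrite cX eqxx.
Qed.

Lemma mixed_ramsey_ex (m n : nat) : exists N, mixed_ramsey_prop m n N.
Proof.
have [N /forallP h] := ramsey_ex m n; exists N; apply/forallP => c.
have /orP[/has_independent_irredundant->//|->] := h c.
by rewrite orbT.
Qed.

Definition ramsey (m n : nat) : nat := ex_minn (ramsey_ex m n).
Definition mixed_ramsey (m n : nat) : nat := ex_minn (mixed_ramsey_ex m n).

(* Main.v *)
Require Import Defs.
From HB Require Import structures.
From mathcomp Require Import all_boot all_order all_algebra all_field.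
From mathcomp Require Import ring zify.

(**
Upper bound, [t(4,n) = O(n^(14/5))].  A red graph that avoids both structures is
[K4]-free, and no red neighbourhood contains a hexagon whose three pairs of
opposite vertices are non-adjacent: the hexagon provides the private neighbours
that make three alternate vertices together with the centre irredundant.  So it
suffices to bound the size of a triangle-free graph without such a hexagon and
with independence number below [n].  There, for non-adjacent [y] and [y'], the
bipartite graph between [N(y)] and [N(y')] has no induced [2K2], so its
neighbourhoods are nested and [m] edges are covered by [O(sqrt m)] vertices.  If
the graph is large, many neighbourhoods can therefore be made disjoint and
mutually non-adjacent at a small cost, and their union is a large independent set.

Lower bound, [r(4,n) = Omega(n^(49/17))], a variant of the argument of Mattheus
and Verstraete.  In the affine plane over a field of order [q^2], take the points
of the Hermitian curve [y^q + y = x^(q+1)] and the lines meeting it in [q+1]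
points.  Two lines are joined if they meet on the curve; the curve contains no
O'Nan configuration, so every [K4] has three concurrent lines, and splitting the
pencil of every point at random into two classes, keeping only the edges between
classes, destroys all [K4].  After the splitting, every set of [16 q^2] lines
still spans many edges, which bounds the independence polynomial and hence the
number of independent sets of size [t = q^(17/16)]; a random sample of the lines
then contains none.
*)

Set Implicit Arguments.
Unset Strict Implicit.
Unset Printing Implicit Defensive.
Import Order.TTheory GRing.Theory Num.Theory.

(** * The upper bound *)

Lemma subset_of_card (T : finType) (A : {set T}) k : k <= #|A| ->
  exists2 B : {set T}, B \subset A & #|B| = k.
Proof.
move=> kA; have : 0 < #|[set B : {set T} | B \subset A & #|B| == k]|.
  by rewrite cards_draws bin_gt0.
by case/card_gt0P=> B; rewrite inE => /andP[sB /eqP cB]; exists B.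
Qed.

(** Each chosen vertex discards itself and fewer than [D] neighbours, hence at most [D] vertices. *)
Lemma greedy_independent (T : finType) (e : rel T) (A : {set T}) D :
  symmetric e -> irreflexive e ->
  (forall a, a \in A -> #|[set b in A | e a b]| < D) ->
  exists X : {set T}, [/\ X \subset A, independent e X & #|A| <= #|X| * D].
Proof.
move=> se ie; have [k] := ubnP #|A|; elim: k A => // k IH A ltk hA.
have [->|[a aA]] := set_0Vmem A.
  exists set0; split; rewrite ?sub0set ?cards0 //.
  by apply/forall_inP => x; rewrite inE.
pose A' := [set b in A | (b != a) && ~~ e a b].
have sA' : A' \subset A by apply/subsetP => b; rewrite inE => /andP[].
have cA : #|A| <= D + #|A'|.
  rewrite -(cardsID [set b | (b != a) && ~~ e a b] A) addnC leq_add //; last first.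
    by apply/subset_leq_card/subsetP => b; rewrite !inE.
  apply: leq_trans (hA a aA).
  rewrite -add1n -[X in _ <= X + _](cards1 a).
  apply: leq_trans (leq_card_setU _ _); apply/subset_leq_card/subsetP => b.
  by rewrite !inE; case: eqP => //= _; case: (e a b); rewrite ?andbF ?andbT.
have ltA' : #|A'| < k.
  apply: leq_trans (ltk : #|A| <= k); apply: proper_card; apply/properP; split=> //.
  by exists a; rewrite // !inE eqxx andbF.
have [|X [sX iX cX]] := IH A' ltA'.
  move=> b bA'; apply: leq_ltn_trans (hA b (subsetP sA' _ bA')).
  by apply/subset_leq_card/subsetP => c; rewrite !inE => /andP[/andP[-> _] ->].
have aX : a \notin X by apply/negP => /(subsetP sX); rewrite !inE eqxx andbF.
exists (a |: X); split.
- by rewrite subUset sub1set aA (subset_trans sX).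
- apply: independentU1 => // b /(subsetP sX).
  by rewrite !inE => /and3P[].
- by rewrite cardsU1 aX mulSn (leq_trans cA) // leq_add2l.
Qed.

Lemma double_count (I J : finType) (r : I -> J -> bool) (B : {set I}) (E : {set J}) :
  \sum_(i in B) #|[set j in E | r i j]| = \sum_(j in E) #|[set i in B | r i j]|.
Proof.
under eq_bigr => i _ do rewrite -sum1dep_card big_mkcondr.
under [RHS]eq_bigr => j _ do rewrite -sum1dep_card big_mkcondr.
exact: exchange_big.
Qed.

Lemma card_bigcup_le (I T : finType) (B : pred I) (f : I -> {set T}) :
  #|\bigcup_(i | B i) f i| <= \sum_(i | B i) #|f i|.
Proof.
elim/big_rec2: _ => [|i n U _ le]; first by rewrite cards0.
by apply: leq_trans (leq_card_setU _ _) _; rewrite leq_add2l.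
Qed.

Lemma card_markov (I : finType) (B : {set I}) (f : I -> nat) k :
  #|[set i in B | k <= f i]| * k <= \sum_(i in B) f i.
Proof.
rewrite -sum_nat_const big_mkcond [leqRHS]big_mkcond /=.
by apply: leq_sum => i _; rewrite inE; case: (i \in B) => //=; case: ifP.
Qed.

(** * Edges between two sets with nested neighbourhoods *)

Section Cover.
Variables (T : finType) (e : rel T).
Hypotheses (se : symmetric e) (ie : irreflexive e).

(** Ordered pairs are counted, so an edge inside [U] contributes 2 to [edge_count U U]. *)
Definition edge_count (S S' : {set T}) := \sum_(a in S) #|[set b in S' | e a b]|.

Lemma edge_countC S S' : edge_count S S' = edge_count S' S.
Proof.
rewrite /edge_count double_count; apply: eq_bigr => b _.
by apply: eq_card => a; rewrite !inE se.
Qed.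

(* [S] and [S'] span a bipartite graph with nested neighbourhoods, so the
   vertices of low degree in [S] share all their neighbours with one of them. *)
Lemma nested_cover (S S' : {set T}) K :
  (forall a a' b b', a \in S -> a' \in S -> b \in S' -> b' \in S' ->
     e a b -> e a' b' -> ~~ e a b' -> ~~ e a' b -> false) ->
  edge_count S S' < K * K ->
  exists2 C : {set T}, #|C| <= 2 * K &
    forall a b, a \in S -> b \in S' -> e a b -> (a \in C) || (b \in C).
Proof.
move=> nest eK; pose d a := #|[set b in S' | e a b]|.
pose H := [set a in S | K <= d a].
have cH : #|H| <= K.
  case: (posnP K) => [K0|K0]; first by move: eK; rewrite K0.
  by rewrite -(leq_pmul2r K0) ltnW //; apply: leq_ltn_trans eK; exact: card_markov.
have [E|[a0 a0L]] := set_0Vmem (S :\: H).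
  exists H; first by lia.
  move=> a b aS bS' _; apply/orP; left; apply: contraT => aH.
  by have := in_set0 a; rewrite -E inE aS aH.
case: (arg_maxnP d a0L) => m mL max_m.
have /setDP[mS mH] : m \in S :\: H := mL.
exists (H :|: [set b in S' | e m b]).
  apply: leq_trans (leq_card_setU _ _) _; rewrite mul2n -addnn leq_add //.
  by move: mH; rewrite inE mS -ltnNge => /ltnW.
move=> a b aS bS' eab; rewrite !inE aS bS' /=.
case: (boolP (K <= d a)) => //= dK; rewrite ?orbT //.
apply/orP; right; apply/orP; right; apply: contraT => emb.
have aL : a \in S :\: H by rewrite !inE aS dK.
(* Nestedness would give [a] all neighbours of [m] and also [b], against the maximality of [m]. *)
have : d a <= d m := max_m a aL; rewrite leqNgt => /negP[].
apply: proper_card; apply/properP; split; last by exists b; rewrite !inE bS' ?eab.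
apply/subsetP => b'; rewrite !inE => /andP[b'S' emb']; rewrite b'S' /=.
apply: contraT => eab'.
by have := nest a m b b' aS mS bS' b'S' eab emb' eab' emb.
Qed.
End Cover.

(** * Triangle-free graphs without a hexagon whose opposite vertices are non-adjacent *)

Section HexagonFree.
Variables (T : finType) (e : rel T) (A : {set T}) (x : nat).
Hypotheses (se : symmetric e) (ie : irreflexive e) (x_gt0 : 0 < x).
Hypothesis triangle_free : {in A & &, forall a b c, e a b -> e b c -> ~~ e a c}.
Hypothesis hexagon_free : forall v y z w z' y',
  v \in A -> y \in A -> z \in A -> w \in A -> z' \in A -> y' \in A ->
  e v y -> e y z -> e z w -> e w z' -> e z' y' -> e y' v ->
  ~~ e v w -> ~~ e y z' -> ~~ e z y' -> false.
Hypothesis alpha : forall X : {set T}, X \subset A -> independent e X -> #|X| < x ^ 5.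

Let nb a := [set b in A | e a b].
(* The final independent set consists of [x] neighbourhoods cut down to size [D],
   each losing at most [6 * K * x = D / 2] vertices. *)
Let D := 12 * x ^ 4.
Let K := x ^ 3.
Let V := [set y in A | D <= #|nb y|].

Let nbA a : nb a \subset A.
Proof. by apply/subsetP => b; rewrite inE => /andP[]. Qed.

Let nb_indep a : a \in A -> independent e (nb a).
Proof.
move=> aA; apply/forall_inP => b; rewrite inE => /andP[bA eab].
apply/forall_inP => c; rewrite inE => /andP[cA eac].
by apply/negP => ebc; have /negP[] := triangle_free aA bA cA eab ebc.
Qed.

Let nb_lt a : a \in A -> #|nb a| < x ^ 5.
Proof. by move=> aA; apply: alpha => //; exact: nb_indep. Qed.

Let low_degree_few : #|A :\: V| <= 12 * x ^ 9.
Proof.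
have [|X [sX iX cX]] := @greedy_independent _ e (A :\: V) D se ie.
  move=> a; rewrite !inE => /andP[]; case: (boolP (a \in A)) => //= aA; rewrite -ltnNge => lt_D _.
  by apply: leq_ltn_trans lt_D; apply/subset_leq_card/subsetP => b; rewrite !inE -andbA => /and3P[_ -> ->].
apply: leq_trans cX _; rewrite mulnC /D -mulnA leq_mul2l /=.
by rewrite (expnD x 4 5) leq_mul2l ltnW ?orbT // alpha // (subset_trans sX) // subsetDl.
Qed.

Let S_ex : exists S : T -> {set T}, forall y, y \in V -> S y \subset nb y /\ #|S y| = D.
Proof.
have h y : exists B : {set T}, y \in V -> B \subset nb y /\ #|B| = D.
  case: (boolP (y \in V)) => [|_]; last by exists set0.
  rewrite inE => /andP[_ /subset_of_card[B sB cB]]; by exists B.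
by have [S hS] := fin_all_exists h; exists S.
Qed.

Section Family.
Variable S : T -> {set T}.
Hypothesis hS : forall y, y \in V -> S y \subset nb y /\ #|S y| = D.

Let VA y : y \in V -> y \in A. Proof. by rewrite inE => /andP[]. Qed.
Let S_nb y a : y \in V -> a \in S y -> a \in A /\ e y a.
Proof.
by move=> yV aS; have [/subsetP/(_ a aS)] := hS yV; rewrite inE => /andP[].
Qed.

Let few_S (a : T) : a \in A -> #|[set y in V | a \in S y]| <= x ^ 5.
Proof.
move=> aA; apply: leq_trans (ltnW (nb_lt aA)); apply/subset_leq_card/subsetP => y.
rewrite !inE => /andP[yV aS]; have yV' : y \in V by rewrite inE.
by have [_ eya] := S_nb yV' aS; rewrite VA // se.
Qed.

(** Pairs whose neighbourhoods are expensive to separate; the final family is a greedy independent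
    set for this relation. *)
Let bad y y' := (y != y') &&
  [|| e y y', K <= #|S y :&: S y'| | K * K <= edge_count e (S y) (S y')].

Let bad_sym : symmetric bad.
Proof. by move=> y y'; rewrite /bad eq_sym se setIC edge_countC. Qed.

(** The three kinds of bad partners number fewer than [x ^ 5], at most [12 * x ^ 6] and at most
    [12 * x ^ 8]. The last two are Markov bounds: a vertex lies in at most [x ^ 5] sets [S y'], so
    the intersections sum to at most [D * x ^ 5] and the edges to at most [D * x ^ 10]. *)
Let bad_few y : y \in V -> #|[set y' in V | bad y y']| < 26 * x ^ 8.
Proof.
move=> yV; have yA := VA yV; have [sS cS] := hS yV.
have SA a : a \in S y -> a \in A by move=> /(S_nb yV)[].
pose B1 := [set y' in V | K <= #|S y :&: S y'|].
pose B2 := [set y' in V | K * K <= edge_count e (S y) (S y')].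
have x3 : 0 < x ^ 3 by rewrite expn_gt0 x_gt0.
have h1 : #|B1| <= 12 * x ^ 6.
  rewrite -(leq_pmul2r x3) -mulnA -expnD; apply: leq_trans (card_markov _ _ _) _.
  have -> : \sum_(y' in V) #|S y :&: S y'| = \sum_(y' in V) #|[set a in S y | a \in S y']|.
    by apply: eq_bigr => i _; apply: eq_card => a; rewrite !inE.
  rewrite double_count; apply: (@leq_trans (\sum_(a in S y) x ^ 5)).
    by apply: leq_sum => a /SA; exact: few_S.
  by rewrite sum_nat_const cS /D -mulnA -expnD.
have h2 : #|B2| <= 12 * x ^ 8.
  have x6 : 0 < K * K by rewrite muln_gt0 x3.
  rewrite -(leq_pmul2r x6) /K -expnD -mulnA -expnD expnD.
  apply: leq_trans (card_markov _ _ _) _.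
  rewrite exchange_big /=; apply: (@leq_trans (\sum_(a in S y) x ^ 10)); last first.
    by rewrite sum_nat_const cS /D -mulnA -expnD.
  apply: leq_sum => a /SA aA.
  have -> : \sum_(j in V) #|[set b in S j | e a b]| = \sum_(j in V) #|[set b in nb a | b \in S j]|.
    apply: eq_bigr => j jV; apply: eq_card => b; rewrite !inE andbC -andbA andbCA.
    by case: (boolP (b \in S j)) => bS; rewrite ?andbF //; have [-> _] := S_nb jV bS; rewrite andbT.
  rewrite double_count; apply: (@leq_trans (\sum_(b in nb a) x ^ 5)).
    by apply: leq_sum => b; rewrite inE => /andP[bA _]; exact: few_S.
  by rewrite sum_nat_const (expnD x 5 5) leq_mul2r ltnW ?orbT // nb_lt.
have sub : [set y' in V | bad y y'] \subset nb y :|: (B1 :|: B2).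
  apply/subsetP => z; rewrite inE => /andP[zV /andP[_ h]].
  move: zV h; rewrite !inE => /andP[-> ->] /=.
  by case: (e y z) => //= /orP[->|->]; rewrite ?orbT.
apply: leq_ltn_trans (subset_leq_card sub) _.
apply: leq_ltn_trans (leq_card_setU _ _) _.
have h := leq_card_setU B1 B2.
have h0 := nb_lt yA.
have e1 : x ^ 5 <= x ^ 8 by rewrite leq_pexp2l.
have e2 : x ^ 6 <= x ^ 8 by rewrite leq_pexp2l.
have e3 : 0 < x ^ 8 by rewrite expn_gt0 x_gt0.
apply: leq_ltn_trans (leq_add (ltnW h0) (leq_trans h (leq_add h1 h2))) _.
by move: (x ^ 5) (x ^ 6) (x ^ 8) e1 e2 e3 => ? ? ?; lia.
Qed.

(** An induced pair of edges [a b], [a' b'] between [S y] and [S y'] would close the hexagon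
    [y a b y' b' a'], so [nested_cover] applies. The common points, fewer than [K], are added to
    cover the pairs with [a == b]. *)
Let good_cover y y' : y \in V -> y' \in V -> y != y' -> ~~ bad y y' ->
  exists2 C : {set T}, #|C| <= 3 * K &
    forall a b, a \in S y -> b \in S y' -> (a == b) || e a b -> (a \in C) || (b \in C).
Proof.
move=> yV y'V ny; rewrite /bad ny /= !negb_or -!ltnNge => /and3P[ney hI hE].
have [|C cC hC] := @nested_cover _ e (S y) (S y') K _ hE.
  move=> a a' b b' aS a'S bS bS' eab ea'b' neab' nea'b.
  have [aA eya] := S_nb yV aS; have [a'A eya'] := S_nb yV a'S.
  have [bA eyb] := S_nb y'V bS; have [b'A eyb'] := S_nb y'V bS'.
  apply: (@hexagon_free y a b y' b' a') => //; rewrite ?VA //.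
  - by rewrite se.
  - by rewrite se.
  - by rewrite se.
  - by rewrite se.
exists (C :|: (S y :&: S y')).
  by apply: leq_trans (leq_card_setU _ _) _; lia.
move=> a b aS bS /orP[/eqP E|eab].
  by rewrite !inE aS [in a \in S y']E bS !orbT.
by rewrite !inE; have /orP[->|->] := hC a b aS bS eab; rewrite ?orbT.
Qed.

Lemma hexagon_free_card_family : #|A| < 40 * x ^ 9.
Proof.
rewrite ltnNge; apply/negP => leA.
have cV : 28 * x ^ 9 <= #|V|.
  have := cardsID V A; rewrite (setIidPr _); last by apply/subsetP => y /VA.
  by have := low_degree_few; lia.
have [|Y0 [sY0 iY0 cY0]] := @greedy_independent _ bad V (26 * x ^ 8) bad_sym _ bad_few.
  by move=> y; rewrite /bad eqxx.
(* Fewer than [x] greedy choices would exhaust at most [26 * x ^ 9] vertices, against [cV]. *)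
have [|Y sY cY] := @subset_of_card _ Y0 x.
  rewrite leqNgt; apply/negP => lt_x.
  have : 28 * x ^ 9 <= x * (26 * x ^ 8).
    by apply: leq_trans (leq_trans cV cY0) _; rewrite leq_mul2r ltnW ?orbT.
  rewrite mulnCA -expnS leq_pmul2r // expn_gt0 x_gt0 //.
have YV y : y \in Y -> y \in V by move=> /(subsetP sY)/(subsetP sY0).
have C_ex : exists C : T -> T -> {set T}, forall y y', y \in Y -> y' \in Y -> y != y' ->
    #|C y y'| <= 3 * K /\ forall a b, a \in S y -> b \in S y' ->
      (a == b) || e a b -> (a \in C y y') || (b \in C y y').
  have h y y' : exists C : {set T}, y \in Y -> y' \in Y -> y != y' ->
      #|C| <= 3 * K /\ forall a b, a \in S y -> b \in S y' ->
      (a == b) || e a b -> (a \in C) || (b \in C).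
    case: (boolP (y \in Y)) => [yY|_]; last by exists set0.
    case: (boolP (y' \in Y)) => [y'Y|_]; last by exists set0.
    case: (boolP (y == y')) => [_|ny]; first by exists set0.
    have nb' : ~~ bad y y'.
      by have /forall_inP/(_ _ (subsetP sY _ yY))/forall_inP/(_ _ (subsetP sY _ y'Y)) := iY0.
    by have [C cC hC] := good_cover (YV _ yY) (YV _ y'Y) ny nb'; exists C.
  have h' y : exists C : T -> {set T}, forall y', y \in Y -> y' \in Y -> y != y' ->
      #|C y'| <= 3 * K /\ forall a b, a \in S y -> b \in S y' ->
      (a == b) || e a b -> (a \in C y') || (b \in C y').
    by have [C hC] := fin_all_exists (h y); exists C.
  by have [C hC] := fin_all_exists h'; exists C => y y'; apply: hC.
have {C_ex}[C hC] := C_ex.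
(* The covers are chosen for ordered pairs, so both are removed. This costs at most [6 * K] per
   partner, in total at most half of [D]. *)
pose piece y := S y :\: \bigcup_(y' in Y :\ y) (C y y' :|: C y' y).
have piece_sep y y' a b : y \in Y -> y' \in Y -> y != y' -> a \in piece y -> b \in piece y' ->
    (a == b) || e a b -> false.
  move=> yY y'Y ny; rewrite !inE => /andP[/bigcupP aC aS] /andP[/bigcupP bC bS] h.
  have [_ /(_ a b aS bS h) /orP[aC'|bC']] := hC y y' yY y'Y ny.
    by case: aC; exists y'; rewrite !inE ?aC' // eq_sym ny.
  by case: bC; exists y; rewrite !inE ?bC' ?orbT // ny.
pose U := \bigcup_(y in Y) piece y.
have cp y : y \in Y -> 6 * x ^ 4 <= #|piece y|.
  move=> yY; rewrite /piece cardsD; have [_ ->] := hS (YV _ yY).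
  have : #|\bigcup_(y' in Y :\ y) (C y y' :|: C y' y)| <= 6 * x ^ 4.
    apply: (@leq_trans (\sum_(y' in Y :\ y) 6 * K)).
      apply: leq_trans (card_bigcup_le _ _) _; apply: leq_sum => y'.
      rewrite in_setD1 => /andP[ny y'Y]; apply: leq_trans (leq_card_setU _ _) _.
      have [c1 _] := hC y' y y'Y yY ny; rewrite eq_sym in ny.
      by have [c2 _] := hC y y' yY y'Y ny; lia.
    rewrite sum_nat_const mulnCA leq_mul2l /= /K expnS leq_mul2r orbC -cY.
    by rewrite subset_leq_card ?subD1set.
  by move: (subset_leq_card (subsetIr (S y) (\bigcup_(y' in Y :\ y) (C y y' :|: C y' y)))); rewrite /D; lia.
have UA : U \subset A.
  apply/bigcupsP => y yY; apply: subset_trans (subsetDl _ _) _.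
  by apply/subsetP => a /(S_nb (YV _ yY))[].
have iU : independent e U.
  apply/forall_inP => a /bigcupP[y yY ay]; apply/forall_inP => b /bigcupP[y' y'Y by'].
  apply/negP => eab; have [E|ny] := eqVneq y y'.
    move: ay by'; rewrite -E !inE => /andP[_ aS] /andP[_ bS].
    have [aA eya] := S_nb (YV _ yY) aS; have [bA eyb] := S_nb (YV _ yY) bS.
    by have /negP[] := triangle_free (VA (YV _ yY)) aA bA eya eab.
  by have := piece_sep y y' a b yY y'Y ny ay by'; rewrite eab orbT => /(_ isT).
have := alpha UA iU; rewrite ltnNge => /negP[].
apply: (@leq_trans (\sum_(y in Y) #|piece y|)).
  apply: (@leq_trans (\sum_(y in Y) 6 * x ^ 4)); last by apply: leq_sum => y /cp.
  by rewrite sum_nat_const cY mulnCA -expnS leq_pmull.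
have -> : \sum_(y in Y) #|piece y| = \sum_(y in Y) #|[set a in U | a \in piece y]|.
  apply: eq_bigr => y yY; apply: eq_card => a; rewrite [RHS]inE andbC.
  by case: (boolP (a \in piece y)) => //= ay; apply/esym/bigcupP; exists y.
(* The pieces are disjoint, so each vertex of [U] is counted at most once. *)
rewrite double_count -sum1_card; apply: leq_sum => a _.
rewrite leqNgt; apply/negP => /card_gt1P[y [y']]; rewrite !inE => -[/andP[yY ay] /andP[y'Y ay'] ny].
by have := piece_sep y y' a a yY y'Y ny; rewrite !inE eqxx => /(_ ay ay' isT).
Qed.
End Family.

Lemma hexagon_free_card : #|A| < 40 * x ^ 9.
Proof. by have [S hS] := S_ex; exact: hexagon_free_card_family hS. Qed.
End HexagonFree.

(** * The bound on t(4,n) *)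

Lemma independent_sub (T : finType) (e : rel T) (X Y : {set T}) :
  X \subset Y -> independent e Y -> independent e X.
Proof.
move=> /subsetP sXY /forall_inP iY; apply/forall_inP => x /sXY/iY/forall_inP h.
by apply/forall_inP => y /sXY/h.
Qed.

Lemma has_independentW (T : finType) (e : rel T) n (X : {set T}) :
  independent e X -> n <= #|X| -> has_independent e n.
Proof.
move=> iX /subset_of_card[Y sY cY]; apply/existsP; exists Y.
by rewrite cY eqxx (independent_sub sY).
Qed.

(** All red degrees are below [40 * x ^ 9] by [hexagon_free_card], so a greedy choice among
    [40 * x ^ 14] vertices reaches [x ^ 5] red-independent ones. *)
Lemma mixed_ramsey4_le n x : 0 < x -> n <= x ^ 5 -> mixed_ramsey 4 n <= 40 * x ^ 14.
Proof.
move=> x0 nx; rewrite /mixed_ramsey; case: ex_minnP => m _; apply.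
apply/forallP => c; apply: contraT; rewrite negb_or => /andP[no_irr no_ind].
set e := color_graph c red; set b := color_graph c blue.
have se : symmetric e := color_graph_sym c red.
have ie : irreflexive e := color_graph_irr c red.
have bE u v : b u v = (u != v) && ~~ e u v.
  by rewrite /b /e /color_graph /=; case: (u != v) => //=; case: (c _).
have alpha (X : {set _}) : independent e X -> #|X| < x ^ 5.
  move=> iX; rewrite ltnNge; apply/negP => h; case/negP: no_ind.
  exact: has_independentW iX (leq_trans nx h).
have irr4 u v w z : uniq [:: u; v; w; z] ->
    (forall t, t \in [:: u; v; w; z] -> isolated_in b [set u; v; w; z] t ||
       [exists y, private_neighbor b [set u; v; w; z] t y]) -> false.
  move=> un h; case/negP: no_irr; apply/existsP; exists [set u; v; w; z].
  apply/andP; split; last first.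
    by apply/forall_inP => t tX; apply: h; move: tX; rewrite !inE -!orbA.
  move: un; rewrite /= !inE !negb_or => /and4P[/and3P[h1 h2 h3] /andP[h4 h5] h6 _].
  by rewrite -!setUA !cardsU1 cards1 !inE !negb_or h1 h2 h3 h4 h5 h6.
have dnb u : #|[set v in [set: 'I_(40 * x ^ 14)] | e u v]| < 40 * x ^ 9.
  set A := [set v in _ | _].
  have inA v : (v \in A) = e u v by rewrite !inE.
  have ne s t : e s t -> s != t by apply: contraTneq => ->; rewrite ie.
  have nee a s t : e a s -> ~~ e a t -> s != t by move=> h; apply: contraNneq => <-.
  (* A red triangle together with [u] is a red clique, hence independent in blue and so
     irredundant. *)
  have triangle : {in A & &, forall v w z, e v w -> e w z -> ~~ e v z}.
    move=> v w z; rewrite !inA => uv uw uz vw wz; apply/negP => vz.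
    have iso : independent b [set u; v; w; z].
      have sym : symmetric b by exact: color_graph_sym.
      have irr : irreflexive b by exact: color_graph_irr.
      have nb s t : e s t -> ~~ b s t by rewrite bE => ->; rewrite andbF.
      rewrite -!setUA; do 3?[apply: independentU1 => //]; last first.
      + by move=> t; rewrite !inE => /or3P[] /eqP->; apply: nb.
      + by move=> t; rewrite !inE => /orP[] /eqP->; apply: nb.
      + by move=> t; rewrite !inE => /eqP->; apply: nb.
      apply/forall_inP => s /set1P->; apply/forall_inP => t /set1P->.
      by rewrite irr.
    suff : false by [].
    apply: (irr4 u v w z); first by rewrite /= !inE !negb_or !ne.
    move=> t tX; apply/orP; left; move/forall_inP: iso; apply.
    by move: tX; rewrite !inE -!orbA.
  apply: (@hexagon_free_card _ e) => //; last by move=> X _; exact: alpha.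
  (* The irredundant set is [u, v, z, z']: the centre [u] is isolated in blue, and [v], [z], [z']
     have their opposite vertices [w], [y'], [y] as private blue neighbours. *)
  move=> v y z w z' y'; rewrite !inA.
  move=> uv uy uz uw uz' uy' vy yz zw wz' z'y' y'v nvw nyz' nzy'.
  have priv (X : {set _}) t y1 : y1 \notin X -> t != y1 -> ~~ e t y1 ->
      (forall r, r \in X -> r != t -> e r y1) -> [exists y2, private_neighbor b X t y2].
    move=> h1 h2 h3 h4; apply/existsP; exists y1; rewrite /private_neighbor h1 bE h2 h3 /=.
    by apply/forall_inP => r rX; apply/implyP => rt; rewrite bE h4 // andbF.
  have nvz : ~~ e v z by apply: (triangle v y z); rewrite ?inA.
  have nyy' : ~~ e y y' by apply: (triangle y v y'); rewrite ?inA // se.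
  have vz : z != v by apply: (nee w); rewrite // se.
  have vz' : z' != v by apply: (nee w); rewrite // se.
  have zz' : z != z' by apply: (nee y).
  have vw : w != v by apply: (nee z); rewrite // se.
  have yz' : z' != y by apply: (nee y'); rewrite se.
  have zy' : z != y' by apply: (nee y).
  apply: (irr4 u v z z').
    by rewrite /= !inE !negb_or !(ne u) // zz' ![v == _]eq_sym vz vz'.
  move=> t; rewrite !inE => /or4P[] /eqP->; apply/orP.
  - left; apply/forall_inP => r; rewrite !inE -!orbA bE => /or4P[] /eqP->;
    by rewrite ?eqxx ?uv ?uz ?uz' ?andbF.
  - right; apply: (priv _ _ w) => //.
    + by rewrite !inE !negb_or -!andbA eq_sym ne // vw eq_sym ne // ne.
    + by rewrite eq_sym.
    + by move=> r; rewrite !inE -!orbA => /or4P[] /eqP->; rewrite ?eqxx // se.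
  - right; apply: (priv _ _ y') => //.
    + by rewrite !inE !negb_or -!andbA eq_sym ne // ne // eq_sym zy' eq_sym ne.
    + by move=> r; rewrite !inE -!orbA => /or4P[] /eqP->; rewrite ?eqxx // se.
  - right; apply: (priv _ _ y) => //.
    + by rewrite !inE !negb_or -!andbA eq_sym ne // eq_sym ne // ne // eq_sym.
    + by rewrite se.
    + by move=> r; rewrite !inE -!orbA => /or4P[] /eqP->; rewrite ?eqxx // se.
have [|X [_ iX cX]] := @greedy_independent _ e [set: 'I_(40 * x ^ 14)] (40 * x ^ 9) se ie.
  by move=> u _.
have := alpha X iX; move: cX; rewrite cardsT card_ord => h1 h2.
have : 40 * x ^ 14 < x ^ 5 * (40 * x ^ 9).
  by apply: leq_ltn_trans h1 _; rewrite ltn_pmul2r // muln_gt0 expn_gt0 x0.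
by rewrite mulnCA -expnD ltnn.
Qed.

(** * Hermitian curves *)

Local Open Scope ring_scope.

Section Hermitian.
Variables (F : fieldType) (s : {rmorphism F -> F}).
Hypothesis sK : involutive s.

Definition on_curve (p : F * F) := p.2 + s p.2 == p.1 * s p.1.
Definition on_line (l p : F * F) := p.2 == l.1 * p.1 + l.2.
(* The line [y = m x + c] meets the curve where [x - s m] has norm [discr (m, c)]. *)
Definition discr (l : F * F) := l.1 * s l.1 + l.2 + s l.2.
(** The Hermitian form of the curve at the vectors [(1, p.1, p.2)]; the points of the curve are
    those with [herm p p = 0]. *)
Definition herm (p p' : F * F) := p.2 + s p'.2 - p.1 * s p'.1.

Lemma on_curveE p : on_curve p -> s p.2 = p.1 * s p.1 - p.2.
Proof. by move/eqP<-; rewrite addrC addKr. Qed.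

Lemma line_curveE l p : on_line l p ->
  on_curve p = ((p.1 - s l.1) * s (p.1 - s l.1) == discr l).
Proof.
case: p l => [x y] [m c] /eqP /= ->; rewrite /on_curve /discr /=.
rewrite !(rmorphB, rmorphD, rmorphM) /= sK -subr_eq0 -[RHS]subr_eq0 -oppr_eq0.
by congr (_ == _); ring.
Qed.

(** Shifted by [s l.1], the first coordinates [u, v, w] of [a, b, d] have norm [e = discr l], so
    [s u = e / u]. The expression becomes [e^2 (v - w) (w - u) (v - u) / (u v w)], which this
    substitution negates. *)
Lemma collinear_trace l a b d : discr l != 0 ->
  on_line l a -> on_line l b -> on_line l d ->
  on_curve a -> on_curve b -> on_curve d ->
  s ((b.1 - d.1) * s (a.1 - d.1) * herm a b) =
    - ((b.1 - d.1) * s (a.1 - d.1) * herm a b).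
Proof.
move=> e0 la lb ld; rewrite !(@line_curveE l) //.
set e := discr l in e0 *.
have hE x y : on_line l x -> on_line l y ->
    herm x y = e - (x.1 - s l.1) * s (y.1 - s l.1).
  case: x y {la lb ld} @e e0 => [x1 x2] [y1 y2] e e0; rewrite /on_line /= => /eqP-> /eqP->.
  by rewrite /herm /e /discr /= !(rmorphB, rmorphD, rmorphM) /= sK; ring.
rewrite hE //.
have se : s e = e by rewrite /e /discr !(rmorphD, rmorphM) /= !sK; ring.
have dE x y : x - y = (x - s l.1) - (y - s l.1) by ring.
rewrite (dE b.1 d.1) (dE a.1 d.1).
move: (a.1 - _) (b.1 - _) (d.1 - _) => u v w /eqP hu /eqP hv /eqP hw.
have nz x : x * s x = e -> x != 0.
  by move=> hx; apply/eqP => x0; move: e0; rewrite -hx x0 mul0r eqxx.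
have sx x : x * s x = e -> s x = e / x.
  by move=> hx; rewrite -hx mulrC mulKf // nz.
rewrite !(rmorphM, rmorphB) /= !sK se (sx _ hu) (sx _ hv) (sx _ hw).
field; by rewrite !nz.
Qed.

(* The Gram determinant of three isotropic vectors. *)
Lemma herm_triple a b c : on_curve a -> on_curve b -> on_curve c ->
  herm a b * herm b c * herm c a + s (herm a b * herm b c * herm c a) =
  let d := (b.1 - a.1) * (c.2 - a.2) - (c.1 - a.1) * (b.2 - a.2) in d * s d.
Proof.
case: a b c => [xa ya] [xb yb] [xc yc] /on_curveE /= Ha /on_curveE /= Hb /on_curveE /= Hc.
rewrite /herm /= !(rmorphB, rmorphD, rmorphM) /= !sK Ha Hb Hc; ring.
Qed.

Lemma two_lines_meet l l' p p' : on_line l p -> on_line l p' ->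
  on_line l' p -> on_line l' p' -> p = p' \/ l = l'.
Proof.
case: l l' p p' => [m c] [m' c'] [x y] [x' y']; rewrite /on_line /=.
move=> /eqP-> /eqP-> /eqP E /eqP E'.
have /eqP : (m - m') * (x - x') = 0.
  have -> : (m - m') * (x - x') =
    (m * x + c - (m' * x + c')) - (m * x' + c - (m' * x' + c')) by ring.
  by rewrite E E'; ring.
rewrite mulf_eq0 !subr_eq0 => /orP[/eqP mm|/eqP->]; last by left.
by right; move: E; rewrite mm => /addrI ->.
Qed.

Lemma no_onan l1 l2 l3 l4 p12 p13 p23 p14 p24 p34 :
  discr l1 != 0 -> discr l2 != 0 -> discr l3 != 0 ->
  l1 != l2 ->
  on_curve p12 -> on_curve p13 -> on_curve p23 ->
  on_curve p14 -> on_curve p24 -> on_curve p34 ->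
  on_line l1 p12 -> on_line l2 p12 -> on_line l1 p13 -> on_line l3 p13 ->
  on_line l2 p23 -> on_line l3 p23 -> on_line l1 p14 -> on_line l4 p14 ->
  on_line l2 p24 -> on_line l4 p24 -> on_line l3 p34 -> on_line l4 p34 ->
  [|| on_line l3 p12, on_line l4 p12, on_line l4 p13 | on_line l4 p23].
Proof.
move=> e1 e2 e3 n12 c12 c13 c23 c14 c24 c34.
move=> i112 i212 i113 i313 i223 i323 i114 i414 i224 i424 i334 i434.
apply/norP => -[n312 /norP[n412 /norP[n413 n423]]].
(* If [phi] is the equation of [l4], the point of [l4] on the side [AB] is
   proportional to [phi(B) A - phi(A) B]; it is isotropic iff the trace of
   [phi(B) s(phi(A)) herm A B] vanishes.  Elements of trace zero are the [z] with
   [s z = - z], so the product over the three sides has trace zero too, which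
   contradicts the Gram determinant [herm_triple]. *)
pose phi (p : F * F) := p.2 - (l4.1 * p.1 + l4.2).
have phi0 p : ~~ on_line l4 p -> phi p != 0 by rewrite /phi subr_eq0.
have key l a b d : discr l != 0 -> on_line l a -> on_line l b -> on_line l d ->
    on_line l4 d -> on_curve a -> on_curve b -> on_curve d ->
    s (phi b * s (phi a) * herm a b) = - (phi b * s (phi a) * herm a b).
  move=> e0 la lb ld l4d ca cb cd.
  have phE x : on_line l x -> phi x = (l.1 - l4.1) * (x.1 - d.1).
    move=> /eqP lx; rewrite /phi lx; move: (l4d); rewrite /on_line (eqP ld) => /eqP E.
    have -> : l4.2 = l.1 * d.1 + l.2 - l4.1 * d.1 by rewrite E; ring.
    ring.
  (* The extra factor is a norm, hence fixed by [s]. *)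
  have -> : phi b * s (phi a) * herm a b =
      (l.1 - l4.1) * s (l.1 - l4.1) * ((b.1 - d.1) * s (a.1 - d.1) * herm a b).
    by rewrite (phE a) // (phE b) // rmorphM /=; ring.
  rewrite rmorphM /= (collinear_trace e0 la lb ld) // rmorphM /= sK; ring.
have k2 := key l2 p12 p23 p24 e2 i212 i223 i224 i424 c12 c23 c24.
have k3 := key l3 p23 p13 p34 e3 i323 i313 i334 i434 c23 c13 c34.
have k1 := key l1 p13 p12 p14 e1 i113 i112 i114 i414 c13 c12 c14.
have := herm_triple c12 c23 c13.
set t := _ * herm p13 p12; set d := _ - _ => /= Ht.
have fA := phi0 _ n412; have fC := phi0 _ n413; have fB := phi0 _ n423.
(* [w] is a nonzero product of norms, and [w * t] is the product of the three elements of trace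
   zero: three sign changes give [s t = - t]. *)
pose w := phi p12 * s (phi p12) * (phi p13 * s (phi p13)) * (phi p23 * s (phi p23)).
have w0 : w != 0 by rewrite !mulf_neq0 // fmorph_eq0.
have sw : s w = w by rewrite /w !rmorphM /= !sK; ring.
have tE : s t = - t.
  apply: (mulfI w0); rewrite -{1}sw -rmorphM /=.
  have -> : w * t = (phi p23 * s (phi p12) * herm p12 p23) *
    (phi p13 * s (phi p23) * herm p23 p13) * (phi p12 * s (phi p13) * herm p13 p12).
    by rewrite /w /t; ring.
  by rewrite [LHS]rmorphM [X in X * _]rmorphM /= k1 k2 k3 /w /t; ring.
move: Ht; rewrite tE subrr => /esym/eqP; rewrite mulf_eq0 fmorph_eq0 orbb => /eqP d0.
(* If [d] vanishes, the three vertices are collinear, which forces [l3] through [p12] or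
   [l1 = l2]. *)
have dE : d = (p23.1 - p12.1) * (p13.2 - (l2.1 * p13.1 + l2.2)).
  by rewrite /d (eqP i212) (eqP i223); ring.
move: d0; rewrite dE => /eqP; rewrite mulf_eq0 !subr_eq0 => /orP[/eqP E|l213].
  have pE : p23 = p12.
    by rewrite [p23]surjective_pairing [p12]surjective_pairing (eqP i212) (eqP i223) E.
  by move: n312; rewrite -pE i323.
have [E|E] := two_lines_meet i112 i113 i212 l213; last by rewrite E eqxx in n12.
by move: n312; rewrite E i313.
Qed.
End Hermitian.

(** * The Frobenius involution and the numbers of points and lines *)

Definition frobn (F : fieldType) p (chF : p \in [pchar F]) (a : nat) (x : F) : F :=
  x ^+ (p ^ a).

Section Frobn.
Variables (F : fieldType) (p : nat) (chF : p \in [pchar F]) (a : nat).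

Fact frobn_zmod_morphism : zmod_morphism (frobn chF a).
Proof.
have chn : [pchar F].-nat (p ^ a)%N by rewrite pnatX pnatE ?chF ?(pcharf_prime chF).
by move=> x y; rewrite /frobn exprDn_pchar // exprNn_pchar.
Qed.

Fact frobn_monoid_morphism : monoid_morphism (frobn chF a).
Proof. by split=> [|x y]; rewrite /frobn ?expr1n ?exprMn. Qed.

HB.instance Definition _ := GRing.isZmodMorphism.Build F F (frobn chF a) frobn_zmod_morphism.
HB.instance Definition _ := GRing.isMonoidMorphism.Build F F (frobn chF a) frobn_monoid_morphism.
End Frobn.

Lemma card_roots_lt (F : finFieldType) (P : {poly F}) : P != 0 ->
  (#|[set x | root P x]| < size P)%N.
Proof.
move=> P0; rewrite cardE; apply: max_poly_roots => //; last exact: enum_uniq.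
by apply/allP => x; rewrite mem_enum inE.
Qed.

Section Counting.
Variables (F : finFieldType) (p : nat) (chF : p \in [pchar F]) (a : nat).
Let q := (p ^ a)%N.
Local Notation s := (frobn chF a).
Hypothesis cF : #|F| = (q ^ 2)%N.

Let q_gt1 : (1 < q)%N.
Proof.
have : (1 < #|F|)%N by apply/card_gt1P; exists 0, 1; rewrite eq_sym oner_neq0.
by rewrite cF; case: q => [|[]].
Qed.

Lemma frobnK : involutive s.
Proof. by move=> x; rewrite /frobn -exprM mulnn -/q -cF expf_card. Qed.

Lemma card_trace_fiber (c : F) : (#|[set y : F | (y + s y)%R == c]| <= q)%N.
Proof.
pose P : {poly F} := 'X^q + ('X - c%:P).
have sP : size P = q.+1.
  by rewrite /P size_polyDl size_polyXn // size_XsubC.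
have P0 : P != 0 by rewrite -size_poly_eq0 sP.
have := card_roots_lt P0; rewrite sP ltnS; apply: leq_trans.
apply/subset_leq_card/subsetP => y; rewrite !inE /root /P hornerD hornerXn hornerXsubC.
by move=> /eqP<-; rewrite /frobn -/q opprD addNKr subrr.
Qed.

Lemma card_norm_fiber_le (e : F) : (#|[set x : F | (x * s x)%R == e]| <= q.+1)%N.
Proof.
pose P : {poly F} := 'X^(q.+1) - e%:P.
have sP : size P = q.+2 by rewrite /P size_XnsubC.
have P0 : P != 0 by rewrite -size_poly_eq0 sP.
have := card_roots_lt P0; rewrite sP ltnS; apply: leq_trans.
apply/subset_leq_card/subsetP => y; rewrite !inE /root /P !hornerE.
by move=> /eqP<-; rewrite /frobn -/q exprS subrr.
Qed.

(** Nonzero elements have their norms among the at most [q - 1] nonzero elements fixed by [s], and a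
    fibre has at most [q + 1] elements. There are [q ^ 2 - 1 = (q - 1) (q + 1)] nonzero elements, so
    every fibre is full. *)
Lemma card_norm_fiber (e : F) : e != 0 -> s e = e ->
  (q < #|[set x : F | (x * s x)%R == e]|)%N.
Proof.
move=> e0 se; rewrite ltnNge; apply/negP => le_q.
pose G := [set x : F | (x != 0) && (s x == x)].
have cG : (#|G| <= q.-1)%N.
  pose P : {poly F} := 'X^(q.-1) - 1%:P.
  have q1 : (0 < q.-1)%N by rewrite -ltnS prednK // ltnW.
  have sP : size P = q by rewrite /P size_XnsubC // prednK // ltnW.
  have P0 : P != 0 by rewrite -size_poly_eq0 sP -lt0n ltnW.
  have := card_roots_lt P0; rewrite sP => h; rewrite -ltnS prednK ?(ltnW q_gt1) //.
  apply: leq_ltn_trans h; apply/subset_leq_card/subsetP => y.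
  rewrite !inE /root /P !hornerE subr_eq0 => /andP[y0 /eqP sy].
  by apply/eqP/(mulfI y0); rewrite -exprS prednK ?(ltnW q_gt1) // mulr1.
have eG : e \in G by rewrite inE e0 se eqxx.
have : (#|F| - 1 <= \sum_(g in G) #|[set x : F | (x * s x)%R == g]|)%N.
  rewrite subn1 -(cardC1 (0 : F)) -sum1_card.
  rewrite (partition_big (fun x => x * s x) (mem G)) /=; last first.
    move=> x; rewrite !inE => x0; rewrite mulf_neq0 ?fmorph_eq0 //=.
    by rewrite rmorphM /= frobnK mulrC.
  apply: leq_sum => g _; rewrite -sum1_card; rewrite big_mkcond [leqRHS]big_mkcond /=.
  by apply: leq_sum => x _; rewrite !inE; case: (x == 0); case: (_ == g).
rewrite (bigD1 e) //= cF leqNgt => /negP[].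
have cG' : (#|G :\ e| <= q.-2)%N.
  by have := cardsD1 e G; rewrite eG; lia.
have h : (\sum_(i in G | i != e) #|[set x | (x * s x)%R == i]| <= q.-2 * q.+1)%N.
  apply: (@leq_trans (#|G :\ e| * q.+1)); last by rewrite leq_mul2r cG' orbT.
  rewrite -sum_nat_const (eq_bigl (mem (G :\ e))); last by move=> x; rewrite !inE andbC.
  by apply: leq_sum => g _; exact: card_norm_fiber_le.
apply: leq_ltn_trans (leq_add le_q h) _.
by move: q_gt1; case: (q) => [|[|k]] //= _; rewrite subn1 expnS expn1 mulnC; nia.
Qed.

Lemma card_curve : (#|[set P : F * F | on_curve s P]| <= q ^ 3)%N.
Proof.
rewrite -sum1_card (eq_bigl (fun P => on_curve s (P.1, P.2))); last first.
  by move=> [x y]; rewrite inE.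
rewrite -(pair_big_dep xpredT (fun x y => on_curve s (x, y)) (fun _ _ => 1%N)) /=.
apply: (@leq_trans (\sum_(x : F) q)).
  apply: leq_sum => x _; rewrite sum1_card; apply: leq_trans (card_trace_fiber (x * s x)).
  by rewrite subset_leq_card //; apply/subsetP => y; rewrite inE.
by rewrite sum_nat_const cF -expnSr.
Qed.

Lemma card_tangents : (#|[set l : F * F | discr s l == 0%R]| <= q ^ 3)%N.
Proof.
rewrite -sum1_card (eq_bigl (fun P => discr s (P.1, P.2) == 0%R)); last first.
  by move=> [x y]; rewrite inE.
rewrite -(pair_big_dep xpredT (fun x y => discr s (x, y) == 0%R) (fun _ _ => 1%N)) /=.
apply: (@leq_trans (\sum_(x : F) q)).
  apply: leq_sum => x _; rewrite sum1_card; apply: leq_trans (card_trace_fiber (- (x * s x))).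
  rewrite subset_leq_card //; apply/subsetP => y; rewrite inE /discr /= => /eqP h.
  by apply/eqP; rewrite -[LHS]subr0 -h; ring.
by rewrite sum_nat_const cF -expnSr.
Qed.

Lemma card_line_curve l : discr s l != 0 ->
  (q < #|[set P : F * F | on_curve s P && on_line l P]|)%N.
Proof.
move=> l0; have se : s (discr s l) = discr s l.
  by rewrite /discr !(rmorphD, rmorphM) /= !frobnK; ring.
apply: leq_trans (card_norm_fiber l0 se) _.
pose f (x : F) := (x + s l.1, l.1 * (x + s l.1) + l.2).
have f_inj : injective f by move=> x y [/addIr].
rewrite -(card_imset _ f_inj); apply/subset_leq_card/subsetP => P /imsetP[x].
rewrite inE => hx ->; have lf : on_line l (f x) by rewrite /on_line /= eqxx.
by rewrite inE lf andbT (@line_curveE _ s frobnK l) //= addrK.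
Qed.
End Counting.

(** This is all that is used of the geometry. Of the [q ^ 4] non-vertical lines at most [q ^ 3] are
    tangents, so at least half remain. Characteristic two makes the later parameters powers of
    two. *)
Lemma hermitian_incidence (a : nat) (q := (2 ^ a)%N) : (0 < a)%N ->
  exists (P L : finType) (inc : P -> L -> bool),
  [/\ (#|P| <= q ^ 3)%N, (q ^ 4 <= 2 * #|L|)%N, (#|L| <= q ^ 4)%N,
      forall l, (q <= #|[set x | inc x l]|)%N &
      (forall x x' l l', inc x l -> inc x l' -> inc x' l -> inc x' l' -> x = x' \/ l = l') /\
      (forall l1 l2 l3 l4 p12 p13 p23 p14 p24 p34, l1 != l2 ->
        inc p12 l1 -> inc p12 l2 -> inc p13 l1 -> inc p13 l3 ->
        inc p23 l2 -> inc p23 l3 -> inc p14 l1 -> inc p14 l4 ->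
        inc p24 l2 -> inc p24 l4 -> inc p34 l3 -> inc p34 l4 ->
        [|| inc p12 l3, inc p12 l4, inc p13 l4 | inc p23 l4])].
Proof.
move=> a0; have [|F chF cF] := @pPrimePowerField 2 (a * 2) isT; first by rewrite muln_gt0 a0.
rewrite expnM -/q in cF.
pose s := frobn chF a; have sK : involutive s := frobnK chF cF.
pose P := {x : F * F | on_curve s x}; pose L := {l : F * F | discr s l != 0}.
have q2 : (2 <= q)%N by rewrite -[2%N]expn1 leq_exp2l.
have cS : #|[set: F * F]| = (q ^ 4)%N by rewrite cardsT card_prod cF -expnD.
exists P, L, (fun x l => on_line (val l) (val x)); split.
- rewrite card_sig; apply: leq_trans (card_curve chF cF).
  by rewrite subset_leq_card //; apply/subsetP => x; rewrite inE.
- rewrite card_sig; have := cardsC [set l : F * F | discr s l == 0].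
  rewrite -cardsT cS; have := card_tangents chF cF.
  rewrite (_ : #|~: _| = #|[pred l | discr s l != 0]|); last by apply: eq_card => l; rewrite !inE.
  have : (2 * q ^ 3 <= q ^ 4)%N by rewrite (expnS _ 3) leq_mul2r q2 orbT.
  by rewrite -/q; set t := #|[set _ | _]|; set u := #|[pred _ | _]|; lia.
- by rewrite card_sig -cS cardsT max_card.
- move=> [l l0] /=; apply: leq_trans (ltnW (card_line_curve cF l0)) _.
  rewrite -[leqRHS](card_imset _ val_inj) subset_leq_card //.
  apply/subsetP => x; rewrite inE => /andP[cx lx].
  by apply/imsetP; exists (exist _ x cx : P); rewrite ?inE.
- split=> [x x' l l' h1 h2 h3 h4|].
    by have [E|E] := two_lines_meet h1 h3 h2 h4; [left|right]; apply: val_inj.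
  move=> [l1 h1] [l2 h2] [l3 h3] [l4 h4] [p12 c12] [p13 c13] [p23 c23] [p14 c14] [p24 c24] [p34 c34].
  rewrite /eq_op /= => n12.
  exact: (no_onan sK h1 h2 h3 n12 c12 c13 c23 c14 c24 c34).
Qed.

Local Close Scope ring_scope.

(** * Random splitting and sampling *)

Definition constant_on (L C : finType) (U : {set L}) (g : {ffun L -> C}) :=
  [forall x in U, forall y in U, g x == g y].

(** A random colouring is constant on a nonempty [U] with probability [#|C| ^ (1 - #|U|)]; here and
    below, probabilities are expressed as counts of functions. *)
Lemma card_constant_on (L C : finType) (U : {set L}) : 0 < #|C| ->
  #|[set g : {ffun L -> C} | constant_on U g]| * #|C| ^ #|U| <= #|C| * #|C| ^ #|L|.
Proof.
move=> C0; have [->|[u0 u0U]] := set_0Vmem U.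
  rewrite cards0 expn0 muln1; apply: leq_trans (max_card _) _; rewrite card_ffun.
  by rewrite leq_pmull.
pose Fam (a : C) := [pred g : {ffun L -> C} | [forall x in U, g x == a]].
have cF a : #|Fam a| * #|C| ^ #|U| = #|C| ^ #|L|.
  pose F (x : L) : pred C := [pred c | (x \in U) ==> (c == a)].
  have -> : #|Fam a| = #|(family F : simpl_pred {ffun L -> C})|.
    apply: eq_card => g; rewrite [LHS]inE; apply/forall_inP/familyP => h x; last first.
      by move=> xU; have := h x; rewrite inE xU.
    by rewrite inE; apply/implyP; exact: h.
  rewrite card_family foldrE big_map -/(index_enum _) big_enum /=.
  rewrite (bigID (mem U)) /= (eq_bigr (fun=> 1)); last first.
    by move=> x xU; rewrite -(card1 a); apply: eq_card => c; rewrite !inE xU.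
  rewrite big1 // mul1n (eq_bigr (fun=> #|C|)); last first.
    by move=> x xU; apply: eq_card => c; rewrite !inE (negPf xU).
  rewrite prod_nat_const -expnD; congr (_ ^ _).
  by rewrite -(cardC U) addnC; congr (_ + _); apply: eq_card => x; rewrite !inE.
have sub : [set g : {ffun L -> C} | constant_on U g] \subset \bigcup_(a : C) [set g | Fam a g].
  apply/subsetP => g; rewrite inE => /forall_inP h; apply/bigcupP; exists (g u0) => //.
  by rewrite inE; apply/forall_inP => x xU; have /forall_inP/(_ _ u0U) := h x xU.
apply: leq_trans (_ : (\sum_(a : C) #|Fam a|) * #|C| ^ #|U| <= _).
  rewrite leq_mul2r; apply/orP; right; apply: leq_trans (subset_leq_card sub) _.
  apply: leq_trans (card_bigcup_le _ _) _; apply: leq_sum => a _.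
  by rewrite subset_leq_card //; apply/subsetP => g; rewrite inE.
by rewrite big_distrl /= (eq_bigr (fun=> #|C| ^ #|L|)) // sum_nat_const.
Qed.

Lemma bin_le_exp n m : 'C(n, m) <= n ^ m.
Proof.
apply: (@leq_trans (n ^_ m)); first by rewrite -bin_ffact leq_pmulr // fact_gt0.
elim: m => // m IH; rewrite ffactnSr expnSr; apply: leq_mul => //; exact: leq_subr.
Qed.

(** * Edge density and maximum degree *)

Section Density.
Variables (T : finType) (e : rel T).
Hypotheses (se : symmetric e) (ie : irreflexive e).
Let deg (U : {set T}) v := #|[set w in U | e v w]|.

Lemma edge_countD1 (U : {set T}) v : v \in U ->
  edge_count e U U = edge_count e (U :\ v) (U :\ v) + 2 * deg U v.
Proof.
move=> vU; rewrite /edge_count (bigD1 v) //= -/(deg U v) mul2n -addnn addnA addnC; congr (_ + _).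
rewrite (eq_bigl (mem (U :\ v))); last by move=> a; rewrite !inE andbC.
have -> : deg U v = \sum_(a in U :\ v) e a v.
  rewrite /deg -sum1dep_card big_mkcond [RHS]big_mkcond /=; apply: eq_bigr => a _.
  rewrite !inE se; have [->|_] := eqVneq a v; first by rewrite ie andbF.
  by case: (a \in U); case: (e a v).
rewrite -big_split; apply: eq_bigr => a _ /=.
by rewrite (cardsD1 v) inE vU /= addnC; congr (_ + _); apply: eq_card => b; rewrite !inE andbA.
Qed.

Lemma sum_edge_countD1 (U : {set T}) :
  \sum_(v in U) edge_count e (U :\ v) (U :\ v) + 2 * edge_count e U U =
  #|U| * edge_count e U U.
Proof.
rewrite -sum_nat_const {2}/edge_count big_distrr -big_split /=.
by apply: eq_bigr => v vU; rewrite (edge_countD1 vU).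
Qed.

(** The density of [U] is the average of the densities of the sets [U :\ v], so the lower bound
    [c2 / c1] at size [R] passes to all larger sets. *)
Lemma density_mono (R c1 c2 : nat) : 1 < R ->
  (forall U : {set T}, #|U| = R -> c2 * (R * R.-1) <= c1 * edge_count e U U) ->
  forall U : {set T}, R <= #|U| -> c2 * (#|U| * #|U|.-1) <= c1 * edge_count e U U.
Proof.
move=> R1 h U; have [k] := ubnP #|U|; elim: k U => // k IH U ltk.
rewrite leq_eqVlt => /orP[/eqP E|ltR]; first by rewrite -E; exact: h.
have u2 : 0 < #|U| - 2 by lia.
have S := sum_edge_countD1 U; rewrite -(leq_pmul2l u2).
have cD v : v \in U -> #|U :\ v| = #|U|.-1 by move=> vU; rewrite (cardsD1 v U) vU.
have : \sum_(v in U) c2 * (#|U|.-1 * #|U|.-2) <= c1 * \sum_(v in U) edge_count e (U :\ v) (U :\ v).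
  rewrite big_distrr /=; apply: leq_sum => v vU.
  by have := IH (U :\ v); rewrite cD //; apply; lia.
rewrite sum_nat_const.
move: (\sum_(v in U) _) S => s S; move: (edge_count e U U) S => E S.
move: (#|U|) u2 S => u u2 S.
have -> : s = (u - 2) * E by rewrite mulnBl; lia.
case: u u2 {S} => [|[|u]] //= _; rewrite subn2 /=; nia.
Qed.

Lemma max_degree_ge (U : {set T}) : U != set0 ->
  exists2 v, v \in U & edge_count e U U <= #|U| * deg U v.
Proof.
move=> /set0Pn[v0 v0U]; case: (arg_maxnP (deg U) v0U) => v vU hv; exists v => //.
by rewrite -sum_nat_const; apply: leq_sum => w; exact: hv.
Qed.
End Density.

(** * Splitting the pencils at random *)

Section RandomBipartition.
Variables (P L : finType) (inc : P -> L -> bool).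
Hypothesis lin : forall x x' l l',
  inc x l -> inc x l' -> inc x' l -> inc x' l' -> x = x' \/ l = l'.

Definition split_adj (f : {ffun P -> {ffun L -> bool}}) : rel L :=
  fun l l' => [exists x, [&& inc x l, inc x l' & f x l != f x l']].

Lemma split_adj_sym f : symmetric (split_adj f).
Proof. by move=> l l'; apply: eq_existsb => x; rewrite andbCA eq_sym. Qed.

Lemma split_adj_irr f : irreflexive (split_adj f).
Proof. by move=> l; apply/existsP => -[x]; rewrite eqxx !andbF. Qed.

Let star (U : {set L}) x := [set l in U | inc x l].
Let mono (f : {ffun P -> {ffun L -> bool}}) U := [set x | constant_on (star U x) (f x)].

(* A line has a neighbour of its own at each of its points whose pencil is not
   monochromatic, since two lines share at most one point. *)
Lemma split_edge_count f (U : {set L}) :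
  \sum_(x in ~: mono f U) #|star U x| <= edge_count (split_adj f) U U.
Proof.
rewrite /star double_count; apply: leq_sum => l lU.
have h x : exists l', (x \in ~: mono f U) && inc x l ->
    [/\ l' \in U, inc x l' & f x l != f x l'].
  case: (boolP (_ && _)) => [|_]; last by exists l.
  rewrite !inE negb_forall_in => /andP[/exists_inP[l1]].
  rewrite inE => /andP[l1U il1]; rewrite negb_forall_in => /exists_inP[l2].
  rewrite inE => /andP[l2U il2] n12 xl.
  have [E|n] := eqVneq (f x l) (f x l1); last by exists l1.
  by exists l2; rewrite E.
have [g hg] := fin_all_exists h.
rewrite -(card_in_imset (f := g)).
  apply/subset_leq_card/subsetP => l' /imsetP[x]; rewrite inE => hx ->.
  have [gU gi gf] := hg x hx; rewrite inE gU /=; apply/existsP; exists x.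
  by rewrite gi gf !andbT; case/andP: hx.
move=> x x' hx hx' E; move: hx hx'; rewrite [_ \in _]inE => hx; rewrite [_ \in _]inE => hx'.
have [gU gi gf] := hg x hx; have [gU' gi' gf'] := hg x' hx'.
case/andP: hx => _ xl; case/andP: hx' => _ x'l; rewrite -E in gi'.
have [//|El] := lin xl gi x'l gi'.
by rewrite -El eqxx in gf.
Qed.

(** Union bound over at most [2 ^ (n * R + #|P|)] pairs of a set [U] and a set of points. All stars
    of such a pair are monochromatic with probability at most [2 ^ (#|P| - h)], as a star of size
    [d] contributes a factor of at most [2 ^ (1 - d)]. *)
Lemma exists_balanced_split (R n h : nat) :
  #|L| <= 2 ^ n -> 2 * #|P| + n * R < h ->
  exists f, forall U : {set L}, #|U| = R -> \sum_(x in mono f U) #|star U x| < h.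
Proof.
move=> cL lt_h.
pose bad (UB : {set L} * {set P}) := [set f : {ffun P -> {ffun L -> bool}} |
   UB.2 \subset mono f UB.1].
pose I := [set UB : {set L} * {set P} | (#|UB.1| == R) && (h <= \sum_(x in UB.2) #|star UB.1 x|)].
have cbad UB : UB \in I -> #|bad UB| * 2 ^ h <= 2 ^ #|P| * (2 ^ #|L|) ^ #|P|.
  case: UB => U B; rewrite inE /= => /andP[_ hB].
  apply: (@leq_trans (#|bad (U, B)| * 2 ^ (\sum_(x in B) #|star U x|))).
    by rewrite leq_mul2l leq_exp2l ?hB ?orbT.
  pose F (x : P) : pred {ffun L -> bool} := [pred g | (x \in B) ==> constant_on (star U x) g].
  have -> : #|bad (U, B)| = #|(family F : simpl_pred {ffun P -> {ffun L -> bool}})|.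
    apply: eq_card => f; rewrite [LHS]inE; apply/subsetP/familyP => /= hf x; last first.
      by move=> xB; have := hf x; rewrite !inE xB.
    by rewrite inE; apply/implyP => /hf; rewrite inE.
  rewrite card_family foldrE big_map -/(index_enum _) big_enum /=.
  rewrite expn_sum (big_mkcond (mem B)) -big_split /=.
  apply: (@leq_trans (\prod_(x : P) (2 * 2 ^ #|L|))); last first.
    by rewrite prod_nat_const expnMn.
  apply: leq_prod => x _; case: (boolP (x \in B)) => xB.
    have := @card_constant_on L bool (star U x); rewrite card_bool => /(_ isT).
    apply: leq_trans; rewrite leq_mul2r; apply/orP; right.
    by rewrite subset_leq_card //; apply/subsetP => g; rewrite !inE xB.
  rewrite muln1; apply: leq_trans (max_card _) _; rewrite card_ffun card_bool.
  by rewrite leq_pmull.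
have cI : #|I| <= 2 ^ (n * R) * 2 ^ #|P|.
  apply: (@leq_trans #|setX [set U : {set L} | #|U| == R] [set: {set P}]|).
    by apply/subset_leq_card/subsetP => -[U B]; rewrite !inE /= => /andP[->].
  rewrite cardsX card_draws cardsT -[X in _ * X]cardsT -powersetT card_powerset cardsT.
  rewrite leq_mul2r; apply/orP; right; apply: leq_trans (bin_le_exp _ _) _.
  by rewrite expnM; case: (R) => // r; rewrite leq_exp2r.
case: (pickP (mem (~: \bigcup_(UB in I) bad UB))) => [f /= | none].
  rewrite inE => /bigcupP nf; exists f => U cU; rewrite ltnNge; apply/negP => hU.
  by case: nf; exists (U, mono f U); rewrite !inE /= ?cU ?eqxx ?hU.
exfalso.
have all : #|{ffun P -> {ffun L -> bool}}| <= \sum_(UB in I) #|bad UB|.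
  apply: leq_trans (card_bigcup_le _ _).
  by rewrite -cardsT subset_leq_card //; apply/subsetP => f _; have := none f; rewrite !inE => /negbFE.
have : #|{ffun P -> {ffun L -> bool}}| * 2 ^ h <= #|I| * (2 ^ #|P| * (2 ^ #|L|) ^ #|P|).
  apply: leq_trans (_ : (\sum_(UB in I) #|bad UB|) * 2 ^ h <= _); first by rewrite leq_mul2r all orbT.
  by rewrite big_distrl /= -sum_nat_const; apply: leq_sum => UB /cbad.
rewrite !card_ffun card_bool mulnA [leqLHS]mulnC leq_pmul2r ?expn_gt0 //.
rewrite leqNgt => /negP[]; apply: leq_ltn_trans (leq_mul cI (leqnn _)) _.
by rewrite -!expnD ltn_exp2l //; lia.
Qed.
End RandomBipartition.

Local Open Scope ring_scope.

(** * Counting independent sets by the independence polynomial *)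

Section IndependencePolynomial.
Variables (T : finType) (e : rel T) (mu : rat).
Hypotheses (mu_ge0 : 0 <= mu) (mu_le1 : mu <= 1).

Definition indep_poly (A : {set T}) : rat :=
  \sum_(I : {set T} | (I \subset A) && independent e I) mu ^+ #|I|.

Lemma indep_poly_rec (A : {set T}) v : v \in A ->
  indep_poly A <= indep_poly (A :\ v) + mu * indep_poly (A :\: (v |: [set w | e v w])).
Proof.
move=> vA; rewrite /indep_poly (bigID (fun I : {set T} => v \notin I)) /= lerD //.
  rewrite big_mkcond [leRHS]big_mkcond ler_sum // => I _.
  by rewrite subsetD1 andbAC.
rewrite (reindex_onto (fun J => v |: J) (fun I => I :\ v)) /=; last first.
  by move=> I /andP[_]; rewrite negbK => /setD1K.
rewrite mulr_sumr big_mkcond [leRHS]big_mkcond ler_sum // => J _.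
case: ifP => [|_]; last by case: ifP => _; rewrite ?mulr_ge0 ?exprn_ge0.
rewrite setU11 andbT => /andP[/andP[sJ iJ] /eqP vJ].
have nvJ : v \notin J by rewrite -vJ !inE eqxx.
rewrite cardsU1 nvJ add1n exprS ifT //; apply/andP; split; last first.
  apply/forall_inP => x xJ; apply/forall_inP => y yJ.
  by have /forall_inP/(_ x)/(_ (setU1r _ xJ))/forall_inP/(_ y)/(_ (setU1r _ yJ)) := iJ.
apply/subsetP => x xJ; rewrite !inE negb_or (subsetP sJ) ?setU1r // andbT.
rewrite (contraTneq _ xJ) => [|-> //] /=.
by have /forall_inP/(_ v)/(_ (setU11 _ _))/forall_inP/(_ x)/(_ (setU1r _ xJ)) := iJ.
Qed.

Lemma indep_poly_small (A : {set T}) : indep_poly A <= (1 + mu) ^+ #|A|.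
Proof.
have mu1 : 1 <= 1 + mu by rewrite lerDl.
have [k] := ubnP #|A|; elim: k A => // k IH A ltk.
have [->|[v vA]] := set_0Vmem A.
  rewrite cards0 expr0 /indep_poly (eq_bigl (pred1 set0)).
    by rewrite big_pred1_eq cards0 expr0.
  move=> I; rewrite subset0 /=; case: eqP => //= ->.
  by apply/forall_inP => x; rewrite inE.
have cA : #|A| = #|A :\ v|.+1 by rewrite (cardsD1 v) vA.
apply: le_trans (indep_poly_rec vA) _; rewrite cA exprS mulrDl mul1r lerD //.
  by apply: IH; rewrite -ltnS -cA.
rewrite ler_wpM2l //; set B := A :\: _.
have cB : (#|B| <= #|A :\ v|)%N by rewrite subset_leq_card // setDS // sub1set setU11.
apply: le_trans (IH B _) _; first by apply: leq_ltn_trans cB _; rewrite -ltnS -cA.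
by rewrite ler_weXn2l.
Qed.

(** Branch on a vertex of large degree. Taking it shrinks the set by the factor [1 - 1 / c], so at
    most [k] takings lead to size [R]; between takings at most [#|T|] vertices are deleted. This
    leaves at most [#|T|.+1 ^ k] branches, each bounded by [(1 + mu) ^+ R]. *)
Lemma indep_poly_le (R c k : nat) (A : {set T}) : (0 < c)%N ->
  (forall U : {set T}, (R <= #|U|)%N ->
     exists2 v, v \in U & (#|U| <= c * #|[set w in U | e v w]|)%N) ->
  (#|A| * c.-1 ^ k <= R * c ^ k)%N ->
  indep_poly A <= #|T|.+1%:R ^+ k * (1 + mu) ^+ R.
Proof.
move=> c0 hR; elim: k A => [|k IHk] A.
  rewrite !expn0 !muln1 expr0 mul1r => leA.
  by apply: le_trans (indep_poly_small A) _; rewrite ler_weXn2l // lerDl.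
have mu1 : 1 <= 1 + mu by rewrite lerDl.
set X := #|T|.+1%:R ^+ k * (1 + mu) ^+ R in IHk *.
have X0 : (1 + mu) ^+ R <= X.
  by rewrite ler_peMl ?exprn_ge0 ?(le_trans ler01) // exprn_ege1 // ler1n.
have X00 : 0 <= X by apply: le_trans X0; rewrite exprn_ge0 // (le_trans ler01).
(* The inner induction runs over deletions: each one adds a single branch bounded by [X]. *)
suff h : (#|A| * c.-1 ^ k.+1 <= R * c ^ k.+1)%N -> indep_poly A <= #|A|.+1%:R * X.
  by move=> /h/le_trans; apply; rewrite exprS -mulrA ler_wpM2r // ler_nat ltnS max_card.
have [n] := ubnP #|A|; elim: n A => // n IH A ltn hA.
have [leA|ltA] := leqP #|A| R.
  apply: le_trans (indep_poly_small A) _; apply: le_trans (_ : (1 + mu) ^+ R <= _).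
    by rewrite ler_weXn2l.
  by apply: le_trans X0 _; rewrite ler_peMl // ler1n.
have [v vA hv] := hR A (ltnW ltA).
apply: le_trans (indep_poly_rec vA) _.
have cA : #|A| = #|A :\ v|.+1 by rewrite (cardsD1 v) vA.
rewrite -natr1 mulrDl mul1r lerD //.
  rewrite cA; apply: IH; first by rewrite -ltnS -cA.
  by apply: leq_trans hA; rewrite leq_mul2r cA leqnSn orbT.
apply: le_trans (_ : indep_poly (A :\: (v |: [set w | e v w])) <= _).
  by rewrite ler_piMl // sumr_ge0 // => I _; rewrite exprn_ge0.
apply: IHk; set B := A :\: _.
have cB : (#|B| + #|[set w in A | e v w]| <= #|A|)%N.
  rewrite -(cardsID [set w | e v w] A) addnC leq_add ?subset_leq_card //.
    by apply/subsetP => w; rewrite !inE.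
  by rewrite /B setDS // subsetUr.
have cB' : (c * #|B| <= c.-1 * #|A|)%N.
  case: (c) c0 hv => // c' _ hv /=; move: cB hv; nia.
rewrite -(leq_pmul2l c0) mulnA; apply: leq_trans (leq_mul cB' (leqnn _)) _.
by rewrite mulnAC -expnS mulnC mulnCA -expnS.
Qed.
End IndependencePolynomial.

(** Bernoulli's inequality [(1 - 1 / (m + 1)) ^ j >= 1 - j / (m + 1)], whose right-hand side is at
    least one half for [j = h]. *)
Lemma succ_exp_le m h : (2 * h <= m.+1)%N -> (m.+1 ^ h <= 2 * m ^ h)%N.
Proof.
have B j : (j <= m.+1)%N -> (m.+1 ^ j * (m.+1 - j) <= m.+1 * m ^ j)%N.
  elim: j => [|j IH] lej; first by rewrite !expn0 subn0 mulnC.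
  have := IH (ltnW lej); rewrite !expnS.
  move: (m.+1 ^ j)%N (m ^ j)%N => x y h'.
  apply: (@leq_trans (m * (x * (m.+1 - j)))%N); last by rewrite [leqRHS]mulnCA leq_mul2l h' orbT.
  by rewrite subSS subSn // [(m.+1 * x)%N]mulnC -mulnA [leqRHS]mulnCA leq_mul //; lia.
move=> h2; have := B h; rewrite (leq_trans _ h2) ?leq_pmull // => /(_ isT) b.
rewrite -(leq_pmul2l (ltn0Sn m)).
apply: (@leq_trans (2 * (m.+1 ^ h * (m.+1 - h)))%N); last by rewrite [leqRHS]mulnCA leq_mul2l.
by rewrite mulnC mulnCA leq_mul2l; apply/orP; right; lia.
Qed.

Lemma card_indep_sets_le (T : finType) (e : rel T) (m t c k : nat) :
  (0 < c)%N -> (0 < m)%N ->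
  (forall U : {set T}, (2 * m * t <= #|U|)%N ->
     exists2 v, v \in U & (#|U| <= c * #|[set w in U | e v w]|)%N) ->
  (#|T| * c.-1 ^ k <= 2 * m * t * c ^ k)%N ->
  (#|[set I : {set T} | (#|I| == t) && independent e I]| <=
    (8 * m) ^ t * #|T|.+1 ^ k)%N.
Proof.
move=> c0 m0 hU hk; set i_t := #|_|; pose M := (2 * m)%N.
have M0 : (0 < M)%N by rewrite muln_gt0.
have MR : (0 : rat) < M%:R by rewrite ltr0n.
(* With this weight [(1 + mu) ^+ (2 * m * t)] is at most [4 ^+ t], and dividing by [mu ^+ t] yields
   the base [4 * M = 8 * m]. *)
pose mu : rat := M%:R^-1.
have mu0 : 0 <= mu by rewrite invr_ge0 ler0n.
have mu1 : mu <= 1 by rewrite invf_le1 // ler1n.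
have h1 : i_t%:R * mu ^+ t <= indep_poly e mu [set: T].
  rewrite -[i_t]sum1_card natr_sum mulr_suml big_mkcond /indep_poly [leRHS]big_mkcond ler_sum // => I _.
  rewrite inE subsetT /= mul1r; case: eqP => [->|_] //=; by case: ifP => _; rewrite ?exprn_ge0.
have h2 := @indep_poly_le T e mu mu0 mu1 (2 * m * t) c k setT c0 hU.
rewrite cardsT in h2; have {h2} := le_trans h1 (h2 hk).
have h4 : (1 + mu) ^+ (2 * m * t) <= 4 ^+ t.
  rewrite exprM lerXn2r ?nnegrE ?exprn_ge0 ?addr_ge0 //.
  have -> : 1 + mu = M.+1%:R / M%:R by rewrite /mu -natr1 mulrDl mul1r divff ?lt0r_neq0 // addrC.
  rewrite expr_div_n ler_pdivrMr ?exprn_gt0 // -!natrX -natrM ler_nat.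
  rewrite mul2n -addnn !expnD (_ : 4 * _ = (2 * M ^ m) * (2 * M ^ m))%N; last by rewrite mulnACA.
  by apply: leq_mul; apply: succ_exp_le.
move=> h3; have {h3 h4} : i_t%:R * mu ^+ t <= #|T|.+1%:R ^+ k * 4 ^+ t.
  by apply: le_trans h3 _; rewrite ler_wpM2l // exprn_ge0.
rewrite /mu exprVn ler_pdivrMr ?exprn_gt0 // -!natrX -!natrM ler_nat => /leq_trans; apply.
by rewrite -mulnA -expnMn mulnC leq_mul2r /M mulnA leqnn orbT.
Qed.

Local Close Scope ring_scope.

(** The sample is the largest class of a random colouring with [M] colours. The hypothesis makes the
    expected number of monochromatic independent [t]-sets smaller than one. *)
Lemma sparse_sample (T : finType) (e : rel T) (M t : nat) : 0 < M ->
  #|[set I : {set T} | (#|I| == t) && independent e I]| * M < M ^ t ->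
  exists2 W : {set T}, #|T| <= M * #|W| &
    forall I : {set T}, I \subset W -> #|I| = t -> ~~ independent e I.
Proof.
move=> M0; set J := [set I | _] => ltJ.
pose bad (I : {set T}) := [set h : {ffun T -> 'I_M} | constant_on I h].
case: (pickP (mem (~: \bigcup_(I in J) bad I))) => [h /= | none]; last first.
  exfalso; have all : #|{ffun T -> 'I_M}| <= \sum_(I in J) #|bad I|.
    apply: leq_trans (card_bigcup_le _ _); rewrite -cardsT subset_leq_card //.
    by apply/subsetP => h _; have := none h; rewrite !inE => /negbFE.
  have : #|{ffun T -> 'I_M}| * M ^ t <= #|J| * (M * M ^ #|T|).
    apply: leq_trans (_ : (\sum_(I in J) #|bad I|) * M ^ t <= _); first by rewrite leq_mul2r all orbT.
    rewrite big_distrl /= -sum_nat_const; apply: leq_sum => I; rewrite inE => /andP[/eqP cI _].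
    by have := @card_constant_on T 'I_M I; rewrite card_ord cI; apply.
  rewrite card_ffun card_ord mulnA [leqRHS]mulnC leq_pmul2l ?expn_gt0 ?M0 //.
  by rewrite leqNgt ltJ.
rewrite inE => /bigcupP hJ.
have [j hj] : exists j : 'I_M, #|T| <= M * #|[set x | h x == j]|.
  pose cl (j : 'I_M) := #|[set x | h x == j]|.
  case: (@arg_maxnP _ (Ordinal M0) xpredT cl isT) => j _ hm; exists j.
  apply: (@leq_trans (\sum_(i : 'I_M) cl j)); last by rewrite sum_nat_const card_ord.
  rewrite -sum1_card (partition_big h xpredT) //=.
  by apply: leq_sum => i _; rewrite sum1dep_card; exact: hm.
exists [set x | h x == j] => // I sI cI; apply/negP => iI; case: hJ; exists I.
  by rewrite inE cI eqxx.
rewrite inE; apply/forall_inP => x /(subsetP sI); rewrite inE => /eqP->.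
by apply/forall_inP => y /(subsetP sI); rewrite inE => /eqP->.
Qed.

(** * The K4-free graph and the bound on r(4,n) *)

(** Three of the four lines share a point. Being adjacent, they would lie pairwise in different
    classes there, but there are only two classes. *)
Lemma split_adj_K4_free (P L : finType) (inc : P -> L -> bool) f :
  (forall x x' l l', inc x l -> inc x l' -> inc x' l -> inc x' l' -> x = x' \/ l = l') ->
  (forall l1 l2 l3 l4 p12 p13 p23 p14 p24 p34, l1 != l2 ->
        inc p12 l1 -> inc p12 l2 -> inc p13 l1 -> inc p13 l3 ->
        inc p23 l2 -> inc p23 l3 -> inc p14 l1 -> inc p14 l4 ->
        inc p24 l2 -> inc p24 l4 -> inc p34 l3 -> inc p34 l4 ->
        [|| inc p12 l3, inc p12 l4, inc p13 l4 | inc p23 l4]) ->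
  let e := split_adj inc f in
  forall a b c d, e a b -> e a c -> e b c -> e a d -> e b d -> ~~ e c d.
Proof.
move=> lin onan e a b c d ab ac bc ad bd; apply/negP => cd.
have col x l l' : e l l' -> inc x l -> inc x l' -> f x l != f x l'.
  move=> ell xl xl'; have /existsP[y /and3P[yl yl' ny]] := ell.
  have [->//|E] := lin _ _ _ _ xl xl' yl yl'.
  by move: ell; rewrite E /e split_adj_irr.
have tri x l l' l'' : e l l' -> e l l'' -> e l' l'' -> inc x l -> inc x l' -> ~~ inc x l''.
  move=> h1 h2 h3 i1 i2; apply/negP => i3.
  by have := (col _ _ _ h1 i1 i2, col _ _ _ h2 i1 i3, col _ _ _ h3 i2 i3);
     case: (f x l) (f x l') (f x l'') => [] [] [] [[]].
have nab : a != b by apply: contraTneq ab => ->; rewrite /e split_adj_irr.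
move: (ab) (ac) (bc) (ad) (bd) (cd).
move=> /existsP[p12 /and3P[? ? _]] /existsP[p13 /and3P[? ? _]] /existsP[p23 /and3P[? ? _]].
move=> /existsP[p14 /and3P[? ? _]] /existsP[p24 /and3P[? ? _]] /existsP[p34 /and3P[? ? _]].
have : [|| inc p12 c, inc p12 d, inc p13 d | inc p23 d] by apply: (onan a b c d p12 p13 p23 p14 p24 p34).
by rewrite (negPf (tri p12 a b c _ _ _ _ _)) // (negPf (tri p12 a b d _ _ _ _ _)) //
     (negPf (tri p13 a c d _ _ _ _ _)) // (negPf (tri p23 b c d _ _ _ _ _)).
Qed.

(** This is [(1 - 1 / c) ^ c <= 1 / 2], obtained from Bernoulli's inequality for [(1 + 1 / d) ^ c]
    with [d = c - 1]. *)
Lemma pred_exp_le c j : 0 < c -> 2 ^ j * c.-1 ^ (c * j) <= c ^ (c * j).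
Proof.
move=> c0; rewrite ![_ ^ (c * j)]expnM -expnMn.
case: j => // j; rewrite leq_exp2r // {j}.
case: c c0 => // d _ /=.
have B n : d ^ n * (d + n) <= d.+1 ^ n * d.
  elim: n => [|n IH]; first by rewrite !expn0 addn0.
  by rewrite !expnS; move: (d ^ n) (d.+1 ^ n) IH => u v; nia.
have := B d.+1; case: (posnP d) => [->|d0]; first by [].
by move=> h; rewrite -(leq_pmul2r d0); apply: leq_trans h; rewrite mulnC mulnA; nia.
Qed.

Lemma exists_K4_free_graph i : 8 <= i ->
  exists (L : finType) (e : rel L) (W : {set L}),
  [/\ symmetric e, irreflexive e,
      forall a b c d, e a b -> e a c -> e b c -> e a d -> e b d -> ~~ e c d,
      2 ^ (245 * i - 9) <= #|W| &
      forall I : {set L}, I \subset W -> #|I| = 2 ^ (85 * i) -> ~~ independent e I].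
Proof.
move=> i8; have [|P [L [inc [cP cL cL' cinc [lin onan]]]]] := @hermitian_incidence (80 * i).
  by lia.
(* As 16 divides 80, [q ^ (17/16)] is the integer [2 ^ (85 * i)]; below, [R] is [16 * q ^ 2]. *)
set q := 2 ^ (80 * i) in cP cL cL' cinc.
have i_lt : i < 2 ^ i := ltn_expl i (isT : 1 < 2).
have i320 : 320 * i + 1 <= 2 ^ (9 + i) by rewrite expnD -[2 ^ 9]/512; lia.
have q4 : q ^ 4 = 2 ^ (320 * i) by rewrite /q -expnM; congr (_ ^ _); lia.
have q3 : q ^ 3 = 2 ^ (240 * i) by rewrite /q -expnM; congr (_ ^ _); lia.
pose R := 2 ^ (160 * i + 4).
have Rq : R * q = 2 * 2 ^ (240 * i + 3).
  by rewrite /R /q -expnS -expnD; congr (_ ^ _); lia.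
have [||f hf] := @exists_balanced_split P L inc R (320 * i) (2 ^ (240 * i + 3)).
- by rewrite -q4.
- have h1 : #|P| <= 2 ^ (240 * i) by rewrite -q3.
  have h2 : 320 * i * R <= 2 ^ (240 * i).
    apply: (@leq_trans (2 ^ (9 + i) * R)); first by rewrite leq_mul2r; apply/orP; right; lia.
    by rewrite /R -expnD leq_exp2l //; lia.
  have h3 : 0 < 2 ^ (240 * i) by rewrite expn_gt0.
  by rewrite [2 ^ (_ + 3)]expnD -[2 ^ 3]/8; move: h1 h2 h3; lia.
pose e := split_adj inc f.
have e_sym : symmetric e := split_adj_sym inc f.
have e_irr : irreflexive e := split_adj_irr inc f.
have R1 : 1 < R by rewrite /R -[1](expn0 2) ltn_exp2l //; lia.
(* [R] lines have at least [R * q] incidences, fewer than half of them in monochromatic pencils. The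
   rest give [R * q / 2] ordered edges, so the density is at least [q / (2 * R)], which is
   [1 / (32 * q)]. *)
have dens (U : {set L}) : #|U| = R -> q * (R * R.-1) <= 2 * R * edge_count e U U.
  move=> cU; have h1 := hf U cU.
  have h2 := split_edge_count lin f U.
  have : #|U| * q <= \sum_(x in [set: P]) #|[set l in U | inc x l]|.
    rewrite double_count -sum_nat_const; apply: leq_sum => l _.
    by apply: leq_trans (cinc l) _; rewrite subset_leq_card //; apply/subsetP => x; rewrite !inE.
  rewrite (big_setID [set x | constant_on [set l in U | inc x l] (f x)]) /= setTI setTD cU Rq => h3.
  have h4 : 2 ^ (240 * i + 3) <= edge_count e U U.
    by apply: leq_trans h2; rewrite -(leq_add2l (2 ^ (240 * i + 3))); move: h1 h3; lia.
  rewrite mulnCA -mulnA [leqRHS]mulnCA leq_mul2l; apply/orP; right.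
  apply: (@leq_trans (R * q)); first by rewrite mulnC leq_mul2r leq_pred orbT.
  by rewrite Rq leq_mul2l h4 orbT.
have q0 : 0 < q by rewrite expn_gt0.
(* Passing from 32 to 64 absorbs the difference between [#|U|.-1] and [#|U|]. *)
have big_deg (U : {set L}) : R <= #|U| ->
    exists2 v, v \in U & #|U| <= 64 * q * #|[set w in U | e v w]|.
  move=> RU; have h := density_mono e_sym e_irr R1 dens RU.
  have [|v vU hv] := @max_degree_ge _ e U.
    by rewrite -card_gt0; lia.
  exists v => //; move: hv; set dv := #|[set w in U | _]| => hv.
  have RE : R = 16 * (q * q) by rewrite /R /q -expnD -[16]/(2 ^ 4) -expnD; congr (_ ^ _); lia.
  have U0 : 0 < #|U| by lia.
  have : q * (#|U| * #|U|.-1) <= 2 * R * (#|U| * dv) by apply: leq_trans h _; rewrite leq_mul2l hv orbT.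
  rewrite mulnCA [leqRHS]mulnCA leq_pmul2l // RE.
  rewrite (_ : 2 * (16 * (q * q)) * dv = q * (32 * q * dv)); last by lia.
  by rewrite leq_pmul2l //; lia.
pose t := 2 ^ (85 * i); pose m := 2 ^ (75 * i + 3); pose c := 2 ^ (80 * i + 6).
have cE : c = 64 * q by rewrite /c /q addnC expnD.
have RE : R = 2 * m * t by rewrite /R /m /t -expnS -expnD; congr (_ ^ _); lia.
pose k := c * (320 * i).
have c0 : 0 < c by rewrite expn_gt0.
have count : #|[set I : {set L} | (#|I| == t) && independent e I]| <= (8 * m) ^ t * #|L|.+1 ^ k.
  apply: (card_indep_sets_le c0); first by rewrite expn_gt0.
    by move=> U; rewrite -RE cE; exact: big_deg.
  rewrite -RE; apply: leq_trans (_ : 2 ^ (320 * i) * c.-1 ^ k <= _).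
    by rewrite leq_mul2r -q4 cL' orbT.
  by apply: leq_trans (pred_exp_le _ c0) _; rewrite leq_pmull // expn_gt0.
pose M := 2 ^ (75 * i + 8).
have [||W cW hW] := @sparse_sample L e M t.
- by rewrite expn_gt0.
- have k0 : 0 < k by rewrite muln_gt0 c0; lia.
  have ME : M = 4 * (8 * m).
    by rewrite /M /m -[4]/(2 ^ 2) -[8]/(2 ^ 3) -!expnD; congr (_ ^ _); lia.
  have L1 : #|L|.+1 <= 2 ^ (320 * i + 1).
    by rewrite addn1 expnS -q4; have := expn_gt0 q 4; rewrite q0; lia.
  (* Since [M] is [4 * (8 * m)], a factor [2 ^ (2 * t)] is available for the remaining terms. The
     bound [8 <= i] enters through [2 * (9 + i) + 80 * i + 6 <= 85 * i]. *)
  have expo : (320 * i + 1) * k + (75 * i + 8) < 2 * t.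
    have h1 : (320 * i + 1) * k <= t.
      apply: (@leq_trans (2 ^ (9 + i) * (c * 2 ^ (9 + i)))).
        by apply: leq_mul => //; rewrite leq_mul2l; apply/orP; right; lia.
      by rewrite /c /t -!expnD leq_exp2l //; lia.
    have h2 : 75 * i + 8 < t.
      by apply: leq_trans (ltn_expl _ (isT : 1 < 2)) _; rewrite leq_exp2l //; lia.
    by lia.
  rewrite [ltnRHS](_ : _ = (8 * m) ^ t * 2 ^ (2 * t)); last by rewrite ME expnMn mulnC [2 ^ (2 * t)]expnM.
  apply: leq_ltn_trans (leq_mul count (leqnn M)) _.
  rewrite -mulnA ltn_pmul2l ?expn_gt0 ?muln_gt0 ?expn_gt0 //.
  apply: (@leq_ltn_trans (2 ^ ((320 * i + 1) * k + (75 * i + 8)))); last by rewrite ltn_exp2l.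
  by rewrite expnD leq_mul // expnM leq_exp2r.
exists L, e, W; split=> //.
- exact: split_adj_K4_free.
- have M0 : 0 < M by rewrite expn_gt0.
  rewrite -(leq_pmul2l M0); apply: leq_trans cW.
  rewrite -(leq_pmul2l (isT : 0 < 2)); apply: leq_trans cL; rewrite q4 /M -expnD -expnS.
  by rewrite leq_exp2l //; lia.
Qed.

Lemma ramsey4_ge i n : 8 <= i -> 2 ^ (85 * i) <= n -> 2 ^ (245 * i - 9) <= ramsey 4 n.
Proof.
move=> i8 len; have [L [e [W [e_sym e_irr K4 cW iW]]]] := exists_K4_free_graph i8.
rewrite /ramsey; case: ex_minnP => N /forallP hN _; rewrite leqNgt; apply/negP => ltN.
have NW : N <= #|W| by apply: leq_trans cW; exact: ltnW.
pose g (x : 'I_N) : L := enum_val (widen_ord NW x).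
have g_inj : injective g by move=> x y /enum_val_inj/(congr1 val)/= E; apply: val_inj.
(* Red is adjacency in the K4-free graph, so a blue-independent set is a clique. Quantifying over
   [S] avoids choosing an order of its two elements. *)
pose c : coloring N := [ffun S : {set 'I_N} => [forall x in S, forall y in S, ~~ e (g x) (g y)]].
have cE x y : c [set x; y] = ~~ e (g x) (g y).
  rewrite ffunE; apply/forall_inP/idP => [/(_ x)|ne z].
    by rewrite set21 => /(_ isT)/forall_inP/(_ y); rewrite set22 => /(_ isT).
  rewrite !inE => /orP[] /eqP->; apply/forall_inP => w; rewrite !inE => /orP[] /eqP->;
  by rewrite ?e_irr // e_sym.
have /orP[/existsP[X /andP[/eqP cX /forall_inP iX]]|/existsP[X /andP[/eqP cX /forall_inP iX]]] := hN c.
  have adj x y : x \in X -> y \in X -> x != y -> e (g x) (g y).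
    move=> xX yX nxy; have /forall_inP/(_ y yX) := iX x xX.
    by rewrite /color_graph /= nxy cE /= /blue eqb_id negbK.
  move: cX; rewrite cardE; have := enum_uniq X; have := mem_enum X.
  case: (enum X) => [|x1 [|x2 [|x3 [|x4 [|? ?]]]]] // hX.
  have [h1 h2 h3 h4] : [/\ x1 \in X, x2 \in X, x3 \in X & x4 \in X].
    by rewrite -!hX !inE !eqxx !orbT.
  rewrite /= !inE !negb_or => /and4P[/and3P[? ? ?] /andP[? ?] ? _] _.
  suff : ~~ e (g x3) (g x4) by rewrite adj.
  by apply: (K4 (g x1) (g x2)); apply: adj.
have [|I sI cI] := @subset_of_card _ (g @: X) (2 ^ (85 * i)).
  by rewrite card_imset // cX.
have sW : I \subset W.
  by apply: subset_trans sI _; apply/subsetP => _ /imsetP[x _ ->]; exact: enum_valP.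
case/negP: (iW I sW cI); apply: independent_sub sI _.
apply/forall_inP => _ /imsetP[x xX ->]; apply/forall_inP => _ /imsetP[y yX ->].
have [->|nxy] := eqVneq x y; first by rewrite e_irr.
have /forall_inP/(_ y yX) := iX x xX; rewrite /color_graph /= nxy cE /= /red.
by case: (e _ _).
Qed.

(** * Comparison of the two bounds and the limit *)

(** With [i] the integer part of [log2 n / 85], the exponents to compare are [6 + 238 * (i + 1) + k]
    and [245 * i - 9]. This requires [253 + k <= 7 * i], and 37 is the least integer with
    [7 * 37 >= 253]. *)
Lemma mixed_ramsey4_small n k :
  2 ^ (85 * (k + 37)) <= n -> mixed_ramsey 4 n * 2 ^ k <= ramsey 4 n.
Proof.
move=> len; pose l := trunc_log 2 n; pose i := l %/ 85.
have n0 : 0 < n by apply: leq_trans len; rewrite expn_gt0.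
have /andP[n_ge n_lt] : 2 ^ l <= n < 2 ^ l.+1 by apply: trunc_log_bounds.
have kl : 85 * (k + 37) < l.+1 by rewrite -(ltn_exp2l _ _ (isT : 1 < 2)) (leq_ltn_trans len).
have il : 85 * i <= l < 85 * i.+1 by rewrite /i; lia.
have ki : k + 37 <= i by rewrite /i; lia.
have r_ge : 2 ^ (245 * i - 9) <= ramsey 4 n.
  apply: ramsey4_ge; first by lia.
  by apply: leq_trans n_ge; rewrite leq_exp2l //; lia.
have t_le : mixed_ramsey 4 n <= 40 * (2 ^ (17 * i.+1)) ^ 14.
  apply: mixed_ramsey4_le; first by rewrite expn_gt0.
  by apply: leq_trans (ltnW n_lt) _; rewrite -expnM leq_exp2l //; lia.
apply: leq_trans r_ge; apply: leq_trans (leq_mul t_le (leqnn _)) _.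
apply: (@leq_trans (2 ^ 6 * 2 ^ (17 * i.+1 * 14) * 2 ^ k)).
  by rewrite -expnM !leq_mul.
by rewrite -!expnD leq_exp2l //; lia.
Qed.

From mathcomp Require Import all_classical all_reals all_analysis.
Import numFieldNormedType.Exports.
Local Open Scope classical_set_scope.
Local Open Scope ring_scope.

Theorem theorem2p7 (R : realType) :
  (fun n : nat => (mixed_ramsey 4 n)%:R / (ramsey 4 n)%:R : R) @ \oo --> (0 : R).
Proof.
apply/cvgr0Pnorm_lt => eps eps0.
pose k := Num.bound eps^-1.
have hk : eps^-1 < (2 ^ k)%:R.
  apply: (lt_trans (archi_boundP _)); first by rewrite invr_ge0 ltW.
  by rewrite ltr_nat ltn_expl.
near=> n.
have le_n : (2 ^ (85 * (k + 37)) <= n)%N by near: n; exact: nbhs_infty_ge.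
have := mixed_ramsey4_small le_n.
(* Division by zero yields 0, which settles a vanishing denominator. *)
have [->|r0] := posnP (ramsey 4 n); first by rewrite invr0 mulr0 normr0.
move=> h; rewrite ger0_norm ?divr_ge0 // ltr_pdivrMr ?ltr0n //.
have t_le : (mixed_ramsey 4 n)%:R * (2 ^ k)%:R <= (ramsey 4 n)%:R :> R.
  by rewrite -natrM ler_nat.
rewrite -ltr_pdivrMl //; case: (posnP (mixed_ramsey 4 n)) => [->|t0].
  by rewrite mulr0 ltr0n.
apply: lt_le_trans t_le; rewrite mulrC ltr_pM2l ?ltr0n //.
Unshelve. all: by end_near.
Qed.
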